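(* Let $f\in V\hat{A}$ be an element of infinite order. Then the infinite cyclic subgroup $\langle f\rangle$ is undistorted in $V\hat{A}$. That is, for a fixed finite generating set of $V\hat{A}$ with word length $\ell$, there is a constant $C>0$ such that $|k|\le C\,\ell(f^k)+C$ for all integers $k$.
   Context: Let $\mathfrak C=\{0,1\}^{\mathbb N}$ be the Cantor set, and let $\phi:\mathfrak C\to[0,1]$ be the map $(x_1,x_2,\dots)\mapsto\sum_i x_i2^{-i}$. Points of $\mathfrak C$ are labelled by real numbers in $[0,1]$. A non-dyadic number has a unique preimage under $\phi$. A dyadic $p\in(0,1)$ has two preimages: $p^-$, whose binary sequence is eventually $1$, and $p^+$, whose binary sequence is eventually $0$. We also write $0^+$ for the all-zero sequence and $1^-$ for the all-one sequence. A one-sided neighborhood of $p^+$ means a set of points with labels in $[p,p+\varepsilon)$ (taking $p^+$ at $p$), and similarly a one-sided neighborhood of $p^-$ corresponds to $(p-\varepsilon,p]$. Thompson's group $V$ is the group of bijections $f$ of $\mathfrak C$ satisfying the following: when drawn as maps $[0,1]\to[0,1]$, they are piecewise linear with finitely many pieces; each piece has slope an integer power of $2$; and each piece starts and ends at points with dyadic coordinates. Brin's group $\hat A$ is the group of homeomorphisms $f$ of $[0,1]$ satisfying the following: - $f(0)=0$ and $f(1)=1$; - $f$ is piecewise linear with slopes powers of $2$ and dyadic breakpoints, where breakpoints may accumulate only at $0$ and $1$; - $f(2x)=2f(x)$ in a neighborhood of $0$; - $f(2x-1)=2f(x)-1$ in a neighborhood of $1$. Elements of $\hat A$ act on $\mathfrak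 C$ via $f(p^\pm)=f(p)^\pm$. The Belk–Hyde–Matucci group $V\hat{A}$ is the group of bijections of $\mathfrak C$ generated by $V$ and $\hat A$. It is finitely generated. It equals the set of bijections $f$ of $\mathfrak C$ such that: - $f$ is piecewise linear with slopes powers of $2$ and pieces beginning and ending at points with dyadic coordinates, where breakpoints may accumulate only at finitely many points, called singularities; - each singularity has the form $p^+$ or $p^-$ with $p$ dyadic, and its image has the form $q^+$ or $q^-$ respectively, with the same sign; - if $f(p^\pm)=q^\pm$ is the image of a singularity, then on a sufficiently small one-sided neighborhood of $p^\pm$ (called a regular neighborhood), $f$ is continuous as a map on $[0,1]$ and satisfies $f\circ L_p=L_q\circ f$, where $L_r(x)=2(x-r)+r$. $\mathrm{Sing}(f)$ denotes the finite set of singularities of $f$. The elements with no singularities are exactly the elements of $V$. Products are written as $fg=g\circ f$. A finitely generated subgroup $H$ of a finitely generated group $G$ is undistorted if, for fixed finite generating sets with word lengths $\ell_H$ and $\ell_G$, there is a constant $C$ with $\ell_H(h)\le C\ell_G(h)+C$ for all $h\in H$. *)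

(* Defs.v *)
From Stdlib Require Import Reals ZArith List.
From Coquelicot Require Import Coquelicot.
Open Scope R_scope.

(** The Cantor set {0,1}^N; index n stands for the coordinate x_{n+1}. *)
Definition Cantor := nat -> bool.

Definition phi (x : Cantor) : R :=
  Series (fun n => if x n then / 2 ^ (S n) else 0).

(** eventually 1 (the points p^- and 1^-) *)
Definition ev1 (x : Cantor) : Prop := exists N, forall n, (N <= n)%nat -> x n = true.
(** eventually 0 (the points p^+ and 0^+) *)
Definition ev0 (x : Cantor) : Prop := exists N, forall n, (N <= n)%nat -> x n = false.

Definition dyadic (r : R) : Prop := exists (m : Z) (n : nat), r = IZR m / 2 ^ n.

Definition bijective (f : Cantor -> Cantor) : Prop :=
  (forall x y, f x = f y -> x = y) /\ (forall y, exists x, f x = y).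

(** x lies in the Cantor piece from a^+ to b^- *)
Definition inPiece (a b : R) (x : Cantor) : Prop :=
  a <= phi x <= b /\ ~ (phi x = a /\ ev1 x) /\ ~ (phi x = b /\ ev0 x).

(** Thompson's group V: piecewise linear, finitely many pieces with dyadic
    endpoints, slopes powers of 2 (so the pieces map increasingly, carrying
    p^+ to q^+ and p^- to q^-). *)
Definition inV (f : Cantor -> Cantor) : Prop :=
  bijective f /\
  exists (n : nat) (a b : nat -> R) (k : nat -> Z),
    a 0%nat = 0 /\ a n = 1 /\
    (forall i, (i < n)%nat -> a i < a (S i)) /\
    (forall i, (i <= n)%nat -> dyadic (a i)) /\
    (forall i, (i < n)%nat -> dyadic (b i)) /\
    (forall i, (i < n)%nat -> forall x, inPiece (a i) (a (S i)) x ->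
        phi (f x) = b i + powerRZ 2 (k i) * (phi x - a i) /\
        (ev1 (f x) <-> ev1 x)).

Definition isAhatF (F : R -> R) : Prop :=
  F 0 = 0 /\ F 1 = 1 /\
  (* homeomorphism of [0,1] (continuous bijection of a compact interval) *)
  (forall x, 0 <= x <= 1 -> 0 <= F x <= 1) /\
  (forall x y, 0 <= x <= 1 -> 0 <= y <= 1 -> F x = F y -> x = y) /\
  (forall y, 0 <= y <= 1 -> exists x, 0 <= x <= 1 /\ F x = y) /\
  (forall x, 0 <= x <= 1 -> forall eps, 0 < eps -> exists delta, 0 < delta /\
     forall y, 0 <= y <= 1 -> Rabs (y - x) < delta -> Rabs (F y - F x) < eps) /\
  (* piecewise linear, slopes powers of 2, dyadic breakpoints, breakpoints
     accumulating only at 0 and 1 *)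
  (forall d e, dyadic d -> dyadic e -> 0 < d -> d < e -> e < 1 ->
     exists (n : nat) (a : nat -> R) (s : nat -> Z),
       a 0%nat = d /\ a n = e /\
       (forall i, (i < n)%nat -> a i < a (S i)) /\
       (forall i, (i <= n)%nat -> dyadic (a i) /\ dyadic (F (a i))) /\
       (forall i, (i < n)%nat -> forall x, a i <= x <= a (S i) ->
          F x = F (a i) + powerRZ 2 (s i) * (x - a i))) /\
  (exists eps, 0 < eps /\ forall x, 0 <= x < eps -> F (2 * x) = 2 * F x) /\
  (exists eps, 0 < eps /\ forall x, 1 - eps < x <= 1 -> F (2 * x - 1) = 2 * F x - 1).

(** Action of \hat A on the Cantor set: f(p^±) = f(p)^±. *)
Definition inAhat (g : Cantor -> Cantor) : Prop :=
  bijective g /\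
  exists F, isAhatF F /\
  forall x, phi (g x) = F (phi x) /\ (ev1 (g x) <-> ev1 x).

(** Words: (true, h) is the letter h, (false, h) is h^{-1}.
    Products are written fg = g o f. *)
Inductive evalw : list (bool * (Cantor -> Cantor)) -> (Cantor -> Cantor) -> Prop :=
| ev_nil : evalw nil (fun x => x)
| ev_pos : forall h w g, evalw w g -> evalw ((true, h) :: w) (fun x => g (h x))
| ev_neg : forall h hi w g,
    (forall x, h (hi x) = x) -> (forall x, hi (h x) = x) ->
    evalw w g -> evalw ((false, h) :: w) (fun x => g (hi x)).

Definition represents (w : list (bool * (Cantor -> Cantor))) (g : Cantor -> Cantor) : Prop :=
  exists g', evalw w g' /\ forall x, g' x = g x.

Definition wordOver (S : list (Cantor -> Cantor)) (w : list (bool * (Cantor -> Cantor))) : Prop :=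
  forall p, In p w -> In (snd p) S.

Definition inVA (g : Cantor -> Cantor) : Prop :=
  bijective g /\
  exists w, (forall p, In p w -> inV (snd p) \/ inAhat (snd p)) /\ represents w g.

Definition genSetVA (S : list (Cantor -> Cantor)) : Prop :=
  (forall s, In s S -> inVA s) /\
  (forall g, inVA g -> exists w, wordOver S w /\ represents w g).

Definition infinite_order (f : Cantor -> Cantor) : Prop :=
  forall n : nat, (1 <= n)%nat -> ~ (forall x, Nat.iter n f x = x).

Definition zpow (f : Cantor -> Cantor) (k : Z) (g : Cantor -> Cantor) : Prop :=
  ((0 <= k)%Z /\ forall x, g x = Nat.iter (Z.to_nat k) f x) \/
  ((k < 0)%Z /\ exists fi, (forall x, f (fi x) = x) /\ (forall x, fi (f x) = x) /\
                 forall x, g x = Nat.iter (Z.to_nat (- k)) fi x).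

(* Main.v *)
Require Import Defs.
From Stdlib Require Import Reals ZArith List Lia Lra Classical ClassicalEpsilon FunctionalExtensionality.
From Coquelicot Require Import Coquelicot.
Open Scope R_scope.

(** The number of singularities and the supremum of [|log_2 f'|] are both subadditive on [VA], so it
    suffices to show that one of them grows linearly along the powers of [f]. If the orbit of a
    singularity is infinite and the germ of a high power at its first singularity is not linear, the
    number of singularities grows linearly. If [f^k] fixes a point and is not the identity near it, an
    orbit converging to that point, or to a nearby fixed point, makes the slopes grow exponentially.
    In the remaining case every singularity disappears for the first return map to the complement of
    finitely many small towers. That map is piecewise linear with finitely many pieces, and a
    pigeonhole argument on prefixes yields either a cone mapped affinely and strictly into itself by
    a power of [f] or of its inverse, hence again exponential slopes, or a bound on all depth changes,
    hence finite order. *)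

(** * Prefix replacements, slopes and their growth *)

(** Two facts restore finiteness. Commutation with the scaling makes every slope near a singularity
    occur already on one compact fundamental domain, which bounds the slopes. And if [f] does not
    grow linearly, the singularities met along an infinite orbit must cancel: the germ of a high
    power [f^m] at the first of them, [p], is linear, since otherwise [f^n] would be singular at [p]
    and at about [n] of its preimages. This cancellation holds for the whole passage from [p] to
    [f^m p], not at the intermediate points; jumping over the passage in a single step is the
    purpose of the towers. Near a periodic singularity the slopes need not be constant, so no single
    derivative measures the attraction; there the lengths of images of intervals are compared with
    the bound on slopes. *)

Definition agree (n : nat) (x y : Cantor) : Prop := forall i, (i < n)%nat -> x i = y i.
Definition glue (n : nat) (x t : Cantor) : Cantor :=
  fun i => if (i <? n)%nat then x i else t (i - n)%nat.
Definition drop (n : nat) (x : Cantor) : Cantor := fun i => x (n + i)%nat.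
Definition const_seq (b : bool) : Cantor := fun _ => b.
Definition push (b : bool) (t : Cantor) : Cantor :=
  fun i => match i with O => b | S j => t j end.

Ltac seqext :=
  apply functional_extensionality; intro;
  unfold glue, drop, const_seq;
  repeat match goal with
  | |- context [(?a <? ?b)%nat] => destruct (Nat.ltb_spec a b)
  end;
  try reflexivity; try lia; try (f_equal; lia).

Lemma agree_refl n x : agree n x x.
Proof. intros i _; reflexivity. Qed.

Lemma agree_sym n x y : agree n x y -> agree n y x.
Proof. intros H i Hi; symmetry; auto. Qed.

Lemma agree_trans n x y z : agree n x y -> agree n y z -> agree n x z.
Proof. intros H K i Hi; rewrite H, K; auto. Qed.

Lemma agree_le n m x y : (n <= m)%nat -> agree m x y -> agree n x y.
Proof. intros H K i Hi; apply K; lia. Qed.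

Lemma agree_all x y : (forall n, agree n x y) -> x = y.
Proof.
  intros H; apply functional_extensionality; intro i; apply (H (S i)); lia.
Qed.

Lemma neq_not_agree x y : x <> y -> exists n, ~ agree n x y.
Proof.
  intros H; apply NNPP; intro K; apply H, agree_all; intro n.
  apply NNPP; intro L; apply K; eauto.
Qed.

Lemma first_difference x y : x <> y -> exists n, agree n x y /\ x n <> y n.
Proof.
  intros H; destruct (neq_not_agree _ _ H) as [n Hn]; revert Hn.
  induction n as [|n IH]; intro Hn.
  - exfalso; apply Hn; intros i Hi; lia.
  - destruct (classic (agree n x y)) as [K|K]; [|auto].
    exists n; split; [exact K|]. intro L; apply Hn; intros i Hi.
    destruct (Nat.eq_dec i n) as [->|]; [exact L|apply K; lia].
Qed.

Lemma glue_drop n x : glue n x (drop n x) = x.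
Proof. seqext. Qed.

Lemma drop_glue n x t : drop n (glue n x t) = t.
Proof. seqext. Qed.

Lemma agree_glue n x t : agree n x (glue n x t).
Proof. intros i Hi; unfold glue; destruct (Nat.ltb_spec i n); [reflexivity|lia]. Qed.

Lemma glue_agree n x y t : agree n x y -> glue n x t = glue n y t.
Proof. intros H; seqext; auto. Qed.

Lemma agree_glue_eq n x y : agree n x y -> y = glue n x (drop n y).
Proof. intros H; rewrite (glue_agree n x y _ H), glue_drop; reflexivity. Qed.

Lemma glue_glue n k x t s : glue (n + k) (glue n x t) s = glue n x (glue k t s).
Proof. seqext. Qed.

Lemma glue_add n k x t : glue (n + k) x t = glue n x (glue k (drop n x) t).
Proof. seqext. Qed.

Lemma glue_glue_same n x t s : glue n (glue n x t) s = glue n x s.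
Proof. seqext. Qed.

Lemma drop_drop n k x : drop k (drop n x) = drop (n + k) x.
Proof. seqext. Qed.

Lemma glue_inj n x t s : glue n x t = glue n x s -> t = s.
Proof. intros H; rewrite <- (drop_glue n x t), H, drop_glue; reflexivity. Qed.

Lemma agree_glue_glue n k x t s : agree k t s -> agree (n + k) (glue n x t) (glue n x s).
Proof.
  intros H i Hi; unfold glue; destruct (Nat.ltb_spec i n); [reflexivity|apply H; lia].
Qed.

Lemma agree_drop n k x y : agree (n + k) x y -> agree k (drop n x) (drop n y).
Proof. intros H i Hi; unfold drop; apply H; lia. Qed.

Lemma push_glue b t : push b t = glue 1 (const_seq b) t.
Proof. apply functional_extensionality; intros [|i]; unfold glue; simpl; [reflexivity|f_equal; lia]. Qed.

Lemma push_inj b s t : push b s = push b t -> s = t.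
Proof. rewrite !push_glue; apply glue_inj. Qed.

Lemma push_head x : x = push (x O) (drop 1 x).
Proof. apply functional_extensionality; intros [|i]; reflexivity. Qed.

Lemma glue_const_seq_push n b t : glue n (const_seq b) (push b t) = glue (n + 1) (const_seq b) t.
Proof. rewrite push_glue; seqext. Qed.

Lemma push_glue_const_seq n b t : push b (glue n (const_seq b) t) = glue n (const_seq b) (push b t).
Proof. rewrite !push_glue; seqext. Qed.

Lemma drop_const_seq n b : drop n (const_seq b) = const_seq b.
Proof. reflexivity. Qed.

(** * Compactness and continuity on the Cantor set *)

(** Dependent choice along prefixes: [Q k] sees only the first [k] digits, so the successive
    extensions fit together to one limit point. Compactness, monotone limits and the slope estimate
    all reduce to this. *)
Lemma bisection (Q : nat -> Cantor -> Prop) (k0 : nat) (x0 : Cantor) :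
  (forall k x y, agree k x y -> Q k x -> Q k y) ->
  Q k0 x0 ->
  (forall k x, (k0 <= k)%nat -> Q k x -> exists y, agree k x y /\ Q (S k) y) ->
  exists z, agree k0 x0 z /\ forall k, (k0 <= k)%nat -> Q k z.
Proof.
  intros Hag H0 Hst.
  assert (Hch : forall k x, exists y, (k0 <= k)%nat -> Q k x -> agree k x y /\ Q (S k) y).
  { intros k x. destruct (classic ((k0 <= k)%nat /\ Q k x)) as [[H1 H2]|H].
    - destruct (Hst k x H1 H2) as [y Hy]; exists y; auto.
    - exists x; tauto. }
  pose (step := fun k x => proj1_sig (constructive_indefinite_description _ (Hch k x))).
  assert (Hstep : forall k x, (k0 <= k)%nat -> Q k x -> agree k x (step k x) /\ Q (S k) (step k x)).
  { intros k x; unfold step; destruct (constructive_indefinite_description _ _); auto. }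
  pose (s := fix s n := match n with O => x0 | S n' => step (k0 + n')%nat (s n') end).
  assert (Hs : forall n, Q (k0 + n)%nat (s n)).
  { induction n; simpl. { rewrite Nat.add_0_r; exact H0. }
    rewrite Nat.add_succ_r; apply Hstep; [lia|assumption]. }
  assert (Hs2 : forall n p, agree (k0 + n) (s n) (s (n + p)%nat)).
  { intros n p; induction p. { rewrite Nat.add_0_r; apply agree_refl. }
    rewrite Nat.add_succ_r; apply agree_trans with (1 := IHp); simpl.
    apply (agree_le _ (k0 + (n + p))); [lia|]. apply Hstep; [lia|apply Hs]. }
  exists (fun i => s (S i) i).
  assert (Hz : forall n, agree (k0 + n) (s n) (fun i => s (S i) i)).
  { intros n i Hi. destruct (le_lt_dec n (S i)) as [H|H].
    - replace (S i) with (n + (S i - n))%nat at 1 by lia. apply Hs2; exact Hi.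
    - symmetry; replace n with (S i + (n - S i))%nat by lia. apply Hs2; lia. }
  split.
  - specialize (Hz O); rewrite Nat.add_0_r in Hz; exact Hz.
  - intros k Hk; replace k with (k0 + (k - k0))%nat by lia.
    eapply Hag; [apply Hz|apply Hs].
Qed.

(** A finite subcover in quantitative form: the local index is both the depth of the cone and the
    bound, and monotonicity lets the larger of two indices serve both halves of a cone. If no index
    worked, failing cones could be bisected down to a point. *)
Lemma cantor_compact (P : nat -> Cantor -> Prop) :
  (forall n m x, (n <= m)%nat -> P n x -> P m x) ->
  (forall x, exists n, forall y, agree n x y -> P n y) ->
  exists n, forall x, P n x.
Proof.
  intros Hmon Hloc. apply NNPP; intro Hno.
  destruct (bisection (fun k x => forall n, exists y, agree k x y /\ ~ P n y) 0 (const_seq true)) as [z [_ Hz]].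
  - intros k x y Hxy H n; destruct (H n) as [w [Hw1 Hw2]]; exists w; split; [|exact Hw2].
    eapply agree_trans; [apply agree_sym|]; eauto.
  - intro n; apply NNPP; intro H; apply Hno; exists n; intro x.
    apply NNPP; intro K; apply H; exists x; split; [intros i Hi; lia|exact K].
  - intros k x _ H.
    assert (Hb : forall b y, agree k x y -> y k = b -> agree (S k) (glue k x (const_seq b)) y).
    { intros b y Hy Hyk i Hi. unfold glue, const_seq. destruct (Nat.ltb_spec i k).
      - apply Hy; lia. - replace i with k by lia; congruence. }
    apply NNPP; intro Hn.
    assert (Hc : forall b, exists n, forall y, agree (S k) (glue k x (const_seq b)) y -> P n y).
    { intro b; apply NNPP; intro Hc; apply Hn; exists (glue k x (const_seq b)); split; [apply agree_glue|].
      intro n; apply NNPP; intro Hd; apply Hc; exists n; intros y Hy.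
      apply NNPP; intro He; apply Hd; exists y; auto. }
    destruct (Hc true) as [n1 H1], (Hc false) as [n2 H2].
    destruct (H (Nat.max n1 n2)) as [y [Hy1 Hy2]]; apply Hy2.
    destruct (y k) eqn:Hk.
    + apply (Hmon n1); [lia|]; apply H1, Hb; auto.
    + apply (Hmon n2); [lia|]; apply H2, Hb; auto.
  - destruct (Hloc z) as [n Hn]. destruct (Hz n (Nat.le_0_l _) n) as [y [Hy1 Hy2]]; auto.
Qed.

Definition inv_pair (f fi : Cantor -> Cantor) : Prop :=
  (forall x, fi (f x) = x) /\ (forall x, f (fi x) = x).

Definition cantor_continuous (f : Cantor -> Cantor) : Prop :=
  forall x M, exists N, forall y, agree N x y -> agree M (f x) (f y).

(** A continuous bijection of a compact space is a homeomorphism. Compactness is applied to the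
    claim that a point whose image is close to [y] is itself close to [fi y]. *)
Lemma cantor_continuous_inv f fi : inv_pair f fi -> cantor_continuous f -> cantor_continuous fi.
Proof.
  intros [H1 H2] Hc y M.
  destruct (cantor_compact (fun n x => agree n (f x) y -> agree M x (fi y))) as [n Hn].
  - intros n m x Hnm H K; apply H; eapply agree_le; eauto.
  - intro x. destruct (classic (x = fi y)) as [->|Hne].
    { exists M; intros z Hz _; apply agree_sym; exact Hz. }
    assert (Hne' : f x <> y) by (intro K; apply Hne; rewrite <- K, H1; reflexivity).
    destruct (neq_not_agree _ _ Hne') as [k Hk]. destruct (Hc x k) as [N HN].
    exists (Nat.max N k); intros z Hz Hzy; exfalso; apply Hk.
    apply agree_trans with (f z).
    + apply HN; eapply agree_le; [|exact Hz]; lia.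
    + eapply agree_le; [|exact Hzy]; lia.
  - exists n; intros z Hz. apply agree_sym, Hn. rewrite H2; apply agree_sym; exact Hz.
Qed.

Lemma cantor_continuous_comp f g : cantor_continuous f -> cantor_continuous g -> cantor_continuous (fun x => g (f x)).
Proof.
  intros Hf Hg x M. destruct (Hg (f x) M) as [K HK], (Hf x K) as [N HN].
  exists N; auto.
Qed.

Lemma cantor_continuous_iter f n : cantor_continuous f -> cantor_continuous (Nat.iter n f).
Proof.
  intros H; induction n; simpl.
  - intros x M; exists M; auto.
  - apply (cantor_continuous_comp _ f); assumption.
Qed.

Lemma inv_pair_sym f fi : inv_pair f fi -> inv_pair fi f.
Proof. intros [? ?]; split; assumption. Qed.

Lemma inv_pair_iter f fi n : inv_pair f fi -> inv_pair (Nat.iter n f) (Nat.iter n fi).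
Proof.
  intros [H1 H2]; split; intro x; induction n; try reflexivity.
  - rewrite Nat.iter_succ_r. simpl. rewrite H1; exact IHn.
  - rewrite Nat.iter_succ_r. simpl. rewrite H2; exact IHn.
Qed.

Lemma inv_pair_inj f fi x y : inv_pair f fi -> f x = f y -> x = y.
Proof. intros [H _] K; rewrite <- (H x), K, H; reflexivity. Qed.

(* In terms of [phi]: [f] is affine with slope [2^(N - M)] on the dyadic interval of length [2^(-N)] around [x]. *)
Definition prefix_map (f : Cantor -> Cantor) (x : Cantor) (N M : nat) : Prop :=
  forall t, f (glue N x t) = glue M (f x) t.

Lemma prefix_map_tail f x N M : prefix_map f x N M -> drop N x = drop M (f x).
Proof.
  intros H. specialize (H (drop N x)). rewrite glue_drop in H.
  rewrite H, drop_glue; reflexivity.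
Qed.

Lemma prefix_map_near f x y N M : prefix_map f x N M -> agree N x y -> prefix_map f y N M.
Proof.
  intros H Hy t. rewrite <- (glue_agree N x y t Hy), H.
  apply glue_agree. rewrite (agree_glue_eq _ _ _ Hy), H. apply agree_glue.
Qed.

Lemma prefix_map_agree f x y N M k : prefix_map f x N M -> agree (N + k) x y -> agree (M + k) (f x) (f y).
Proof.
  intros H Hy.
  rewrite (agree_glue_eq N x y) by (apply (agree_le _ (N + k)); [lia|exact Hy]).
  rewrite H. rewrite <- (glue_drop M (f x)) at 1.
  apply agree_glue_glue. rewrite <- (prefix_map_tail _ _ _ _ H). apply agree_drop; exact Hy.
Qed.

Lemma prefix_map_raise f x N M k : prefix_map f x N M -> prefix_map f x (N + k) (M + k).
Proof.
  intros H t. rewrite (glue_add N), H, (prefix_map_tail _ _ _ _ H), <- (glue_add M); reflexivity.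
Qed.

Lemma prefix_map_comp f g x N M K : prefix_map f x N M -> prefix_map g (f x) M K -> prefix_map (fun y => g (f y)) x N K.
Proof. intros H1 H2 t; rewrite H1, H2; reflexivity. Qed.

Lemma prefix_map_inv f fi x N M : inv_pair f fi -> prefix_map f x N M -> prefix_map fi (f x) M N.
Proof. intros [H1 _] H t; rewrite <- H, !H1; reflexivity. Qed.

Lemma prefix_map_ext f g x N M : (forall y, agree N x y -> f y = g y) -> prefix_map f x N M -> prefix_map g x N M.
Proof.
  intros H K t. rewrite <- (H x), <- H; [apply K|apply agree_glue|apply agree_refl].
Qed.

(** Compare two tails that differ everywhere: the digit at position [M'] would be fixed by the
    longer image prefix and free after the shorter one. *)
Lemma prefix_map_unique_aux f x N M M' : prefix_map f x N M -> prefix_map f x N M' -> (M <= M')%nat.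
Proof.
  intros H H'. destruct (le_lt_dec M M') as [|Hlt]; [assumption|exfalso].
  pose proof (H (const_seq true)) as A; rewrite H' in A.
  pose proof (H (const_seq false)) as B; rewrite H' in B.
  apply (f_equal (fun s => s M')) in A; apply (f_equal (fun s => s M')) in B.
  unfold glue, const_seq in A, B.
  destruct (Nat.ltb_spec M' M') as [|_]; [lia|].
  destruct (Nat.ltb_spec M' M) as [_|]; [congruence|lia].
Qed.

(** Minus the base-2 logarithm of the slope. The difference is unchanged by [prefix_map_raise], so
    it depends only on the germ at [x]. *)
Definition log_contraction (f : Cantor -> Cantor) (x : Cantor) (d : Z) : Prop :=
  exists N M, prefix_map f x N M /\ d = (Z.of_nat M - Z.of_nat N)%Z.

Definition locally_linear (f : Cantor -> Cantor) (x : Cantor) : Prop := exists d, log_contraction f x d.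

Lemma prefix_map_log_contraction f x N M : prefix_map f x N M -> log_contraction f x (Z.of_nat M - Z.of_nat N).
Proof. intros H; exists N, M; auto. Qed.

Lemma log_contraction_unique f x d d' : log_contraction f x d -> log_contraction f x d' -> d = d'.
Proof.
  intros (N & M & H & ->) (N' & M' & H' & ->).
  apply (prefix_map_raise _ _ _ _ N') in H; apply (prefix_map_raise _ _ _ _ N) in H'.
  rewrite (Nat.add_comm N') in H'.
  pose proof (prefix_map_unique_aux _ _ _ _ _ H H'). pose proof (prefix_map_unique_aux _ _ _ _ _ H' H). lia.
Qed.

Lemma log_contraction_comp f g x d e : log_contraction f x d -> log_contraction g (f x) e -> log_contraction (fun y => g (f y)) x (d + e).
Proof.
  intros (N & M & H & ->) (N' & M' & H' & ->).
  exists (N + N')%nat, (M + M')%nat; split; [|lia].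
  apply prefix_map_comp with (M + N')%nat; [apply prefix_map_raise; exact H|].
  rewrite (Nat.add_comm M), (Nat.add_comm M). apply prefix_map_raise; exact H'.
Qed.

Lemma log_contraction_inv f fi x d : inv_pair f fi -> log_contraction f x d -> log_contraction fi (f x) (- d).
Proof.
  intros Hp (N & M & H & ->). exists M, N; split; [|lia]. apply (prefix_map_inv f); assumption.
Qed.

Lemma log_contraction_near f x d : log_contraction f x d -> exists N, forall y, agree N x y -> log_contraction f y d.
Proof.
  intros (N & M & H & ->). exists N; intros y Hy. apply prefix_map_log_contraction. eapply prefix_map_near; eauto.
Qed.

Lemma log_contraction_ext f g x d K : (forall y, agree K x y -> f y = g y) -> log_contraction f x d -> log_contraction g x d.
Proof.
  intros H (N & M & HP & ->). exists (N + K)%nat, (M + K)%nat; split; [|lia].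
  apply prefix_map_ext with f; [|apply prefix_map_raise; exact HP].
  intros y Hy; apply H; eapply agree_le; [|exact Hy]; lia.
Qed.

Lemma locally_linear_comp f g x : locally_linear f x -> locally_linear g (f x) -> locally_linear (fun y => g (f y)) x.
Proof. intros [d H] [e K]; exists (d + e)%Z; apply log_contraction_comp; assumption. Qed.

Lemma locally_linear_inv f fi x : inv_pair f fi -> locally_linear f x -> locally_linear fi (f x).
Proof. intros Hp [d H]; exists (- d)%Z; apply log_contraction_inv; assumption. Qed.

Lemma locally_linear_id x : locally_linear (fun y => y) x.
Proof. exists 0%Z, O, O; split; [|reflexivity]. intro t; seqext. Qed.

Lemma locally_linear_cantor_continuous f x : locally_linear f x -> forall M, exists N, forall y, agree N x y -> agree M (f x) (f y).
Proof.
  intros [d (N & M0 & H & _)] M. exists (N + M)%nat; intros y Hy.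
  eapply agree_le; [|eapply prefix_map_agree; eauto]; lia.
Qed.

(* Both bounds are subadditive under composition and invariant under inversion, hence at most linear in the word length. *)
Definition bounded_by (f : Cantor -> Cantor) (A L : nat) : Prop :=
  exists E, (length E <= A)%nat /\
    forall x, ~ In x E -> exists d, log_contraction f x d /\ (Z.abs d <= Z.of_nat L)%Z.

Lemma bounded_by_id : bounded_by (fun x => x) 0 0.
Proof.
  exists nil; split; [auto|]. intros x _. exists 0%Z; split; [|simpl; lia].
  exists O, O; split; [|reflexivity]. intro t; seqext.
Qed.

Lemma bounded_by_comp f fi g A L A' L' :
  inv_pair f fi -> bounded_by f A L -> bounded_by g A' L' -> bounded_by (fun x => g (f x)) (A + A') (L + L').
Proof.
  intros [H1 _] (E & HE & H) (E' & HE' & H').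
  exists (E ++ map fi E'); split.
  - rewrite length_app, length_map; lia.
  - intros x Hx. rewrite in_app_iff in Hx.
    destruct (H x) as (d & Hd & Hd'); [tauto|].
    destruct (H' (f x)) as (e & He & He').
    { intro K; apply Hx; right. rewrite <- (H1 x); apply in_map; exact K. }
    exists (d + e)%Z; split; [apply log_contraction_comp; assumption|lia].
Qed.

Lemma bounded_by_inv f fi A L : inv_pair f fi -> bounded_by f A L -> bounded_by fi A L.
Proof.
  intros Hp (E & HE & H). exists (map f E); split; [rewrite length_map; exact HE|].
  intros x Hx. destruct Hp as [H1 H2]. destruct (H (fi x)) as (d & Hd & Hd').
  { intro K; apply Hx. rewrite <- (H2 x). apply in_map; exact K. }
  exists (- d)%Z; split; [|lia].
  rewrite <- (H2 x). apply log_contraction_inv; [split; assumption|exact Hd].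
Qed.

Lemma bounded_by_mono f A L A' L' : (A <= A')%nat -> (L <= L')%nat -> bounded_by f A L -> bounded_by f A' L'.
Proof.
  intros HA HL (E & HE & H); exists E; split; [lia|].
  intros x Hx; destruct (H x Hx) as (d & Hd & Hd'); exists d; split; [exact Hd|lia].
Qed.

Lemma bounded_by_iter f fi A L n : inv_pair f fi -> bounded_by f A L -> bounded_by (Nat.iter n f) (n * A) (n * L).
Proof.
  intros Hp H; induction n; [exact bounded_by_id|].
  change (bounded_by (fun x => f (Nat.iter n f x)) (S n * A) (S n * L)).
  apply (bounded_by_mono _ (n * A + A) (n * L + L)); [lia|lia|].
  apply bounded_by_comp with (Nat.iter n fi); [apply inv_pair_iter; exact Hp|exact IHn|exact H].
Qed.

Lemma cone_avoids_list (E : list Cantor) x N : exists y, agree N x y /\ ~ In y E.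
Proof.
  revert x N; induction E as [|e E IH]; intros x N.
  - exists x; split; [apply agree_refl|auto].
  - set (b := negb (e N)).
    destruct (IH (glue N x (const_seq b)) (S N)) as [y [Hy Hn]].
    exists y; split.
    + intros i Hi; rewrite <- Hy by lia. apply agree_glue; exact Hi.
    + intros [->|K]; [|auto]. specialize (Hy N (Nat.lt_succ_diag_r N)).
      unfold glue, const_seq in Hy; rewrite Nat.ltb_irrefl in Hy. unfold b in Hy. destruct (y N); discriminate.
Qed.

(** The bound extends to exceptional points at which [f] happens to be linear: the slope is locally
    constant, and every cone contains a point outside the finite list. *)
Lemma bounded_by_slope f A L x d : bounded_by f A L -> log_contraction f x d -> (Z.abs d <= Z.of_nat L)%Z.
Proof.
  intros (E & _ & H) Hd. destruct (log_contraction_near _ _ _ Hd) as [N HN].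
  destruct (cone_avoids_list E x N) as [y [Hy1 Hy2]].
  destruct (H y Hy2) as (d' & H1 & H2).
  rewrite (log_contraction_unique _ _ _ _ (HN y Hy1) H1); exact H2.
Qed.

(** * Linear growth along the powers of a map *)

(** The sum [A + L] lets many singularities and steep slopes be used interchangeably as witnesses of
    growth. *)
Definition linear_growth (f : Cantor -> Cantor) : Prop :=
  exists C : nat, forall n A L, bounded_by (Nat.iter n f) A L -> (n <= C * (A + L) + C)%nat.

Lemma iter_mul n m (f : Cantor -> Cantor) x : Nat.iter n (Nat.iter m f) x = Nat.iter (n * m) f x.
Proof.
  induction n; [reflexivity|]. simpl Nat.mul. rewrite Nat.iter_add, <- IHn; reflexivity.
Qed.

(** [n] is rounded up to the multiple [q * m]; the [r <= m] additional steps cost a constant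
    depending only on [m], [A0] and [L0]. *)
Lemma linear_growth_iter f fi A0 L0 m :
  inv_pair f fi -> bounded_by f A0 L0 -> (1 <= m)%nat -> linear_growth (Nat.iter m f) -> linear_growth f.
Proof.
  intros Hp Hb Hm [C HC]. exists (m * C * (1 + m * A0 + m * L0))%nat. intros n A L H.
  set (q := (n / m + 1)%nat). set (r := (q * m - n)%nat).
  pose proof (Nat.div_mod n m ltac:(lia)) as Hdm.
  pose proof (Nat.mod_upper_bound n m ltac:(lia)) as Hmod.
  assert (Hr : (r <= m)%nat) by (unfold r, q; nia).
  assert (Hq : (q * m = r + n)%nat) by (unfold r, q; nia).
  assert (HB : bounded_by (Nat.iter q (Nat.iter m f)) (A + m * A0) (L + m * L0)).
  { replace (Nat.iter q (Nat.iter m f)) with (fun x => Nat.iter r f (Nat.iter n f x)).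
    - apply (bounded_by_mono _ (A + r * A0) (L + r * L0)); [nia|nia|].
      apply bounded_by_comp with (Nat.iter n fi); [apply inv_pair_iter; exact Hp|exact H|].
      apply (bounded_by_iter f fi); assumption.
    - apply functional_extensionality; intro x. rewrite iter_mul, Hq, Nat.iter_add; reflexivity. }
  apply HC in HB.
  assert (n <= m * q)%nat by nia.
  assert (m * q <= m * (C * (A + m * A0 + (L + m * L0)) + C))%nat by nia.
  nia.
Qed.

Lemma linear_growth_inv f fi : inv_pair f fi -> linear_growth fi -> linear_growth f.
Proof.
  intros Hp [C HC]; exists C; intros n A L H; apply HC.
  apply (bounded_by_inv (Nat.iter n f)); [apply inv_pair_iter; exact Hp|exact H].
Qed.

Lemma linear_growth_slope f x d : (d <> 0)%Z -> (forall n, log_contraction (Nat.iter n f) x (d * Z.of_nat n)) -> linear_growth f.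
Proof.
  intros Hd H. exists 1%nat; intros n A L HB.
  pose proof (bounded_by_slope _ _ _ _ _ HB (H n)). nia.
Qed.

(** The image of the cone at [z] lies in that same cone, so each further iterate contracts by the
    same factor and the exponents add up to [d * n]. *)
Lemma linear_growth_contract f z D d : (1 <= d)%nat -> prefix_map f z D (D + d) -> agree D z (f z) -> linear_growth f.
Proof.
  intros Hd H Ha. apply (linear_growth_slope f z (Z.of_nat d)); [lia|]. intro n.
  assert (K : prefix_map (Nat.iter n f) z D (D + d * n) /\ agree D z (Nat.iter n f z)).
  { induction n.
    - rewrite Nat.mul_0_r, Nat.add_0_r. split; [intro t; reflexivity|apply agree_refl].
    - destruct IHn as [IH1 IH2].
      assert (HP : prefix_map f (Nat.iter n f z) D (D + d)) by (eapply prefix_map_near; eauto).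
      split.
      + apply (prefix_map_comp (Nat.iter n f) f _ _ (D + d * n)); [exact IH1|].
        replace (D + d * S n)%nat with (D + d + d * n)%nat by nia.
        apply prefix_map_raise; exact HP.
      + simpl. apply agree_trans with (f z); [exact Ha|].
        pose proof (fun y => prefix_map_agree _ z y _ _ 0 H) as Q. specialize (Q (Nat.iter n f z)). rewrite !Nat.add_0_r in Q.
        eapply agree_le; [|apply Q; exact IH2]; lia. }
  destruct K as [K _]. exists D, (D + d * n)%nat; split; [exact K|lia].
Qed.

Lemma log_contraction_iter_fixed f x d n : f x = x -> log_contraction f x d -> log_contraction (Nat.iter n f) x (d * Z.of_nat n).
Proof.
  intros Hx H. assert (Hf : forall k, Nat.iter k f x = x).
  { induction k; simpl; [reflexivity|congruence]. }
  induction n.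
  - rewrite Z.mul_0_r. exists O, O; split; [|reflexivity]. intro t; reflexivity.
  - replace (d * Z.of_nat (S n))%Z with (d * Z.of_nat n + d)%Z by lia.
    apply (log_contraction_comp (Nat.iter n f) f); [exact IHn|]. rewrite Hf; exact H.
Qed.

Lemma locally_linear_fixed f x : f x = x -> locally_linear f x ->
  linear_growth f \/ exists N, forall y, agree N x y -> f y = y.
Proof.
  intros Hx [d H]. destruct (Z.eq_dec d 0) as [->|Hd].
  - right. destruct H as (N & M & HP & HNM). assert (N = M) by lia; subst M.
    exists N; intros y Hy. rewrite (agree_glue_eq _ _ _ Hy), HP, Hx; reflexivity.
  - left. apply (linear_growth_slope f x d Hd). intro n; apply log_contraction_iter_fixed; assumption.
Qed.

(** * Germs at singularities *)

(* The lexicographic order for [b = false], its reverse for [b = true]; in both cases the constant sequence [const_seq b] is the minimum. *)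
Definition lex_lt (b : bool) (x y : Cantor) : Prop :=
  exists n, agree n x y /\ x n = b /\ y n = negb b.

Lemma lex_lt_irrefl b x : ~ lex_lt b x x.
Proof. intros (n & _ & H & K). rewrite H in K. destruct b; discriminate. Qed.

Lemma lex_lt_trans b x y z : lex_lt b x y -> lex_lt b y z -> lex_lt b x z.
Proof.
  intros (n & H1 & H2 & H3) (m & K1 & K2 & K3).
  destruct (lt_eq_lt_dec n m) as [[L|L]|L].
  - exists n; split; [|split; [exact H2|rewrite <- K1; assumption]].
    apply agree_trans with y; [exact H1|]. eapply agree_le; [|exact K1]; lia.
  - subst m. rewrite K2 in H3. destruct b; discriminate.
  - exists m; split; [|split; [rewrite H1; assumption|exact K3]].
    apply agree_trans with y; [|exact K1]. eapply agree_le; [|exact H1]; lia.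
Qed.

Lemma lex_lt_total b x y : x <> y -> lex_lt b x y \/ lex_lt b y x.
Proof.
  intros H. destruct (first_difference _ _ H) as [n [H1 H2]].
  destruct (Bool.bool_dec (x n) b) as [Hx|Hx].
  - left; exists n; repeat split; auto. destruct b, (x n), (y n); simpl; congruence.
  - right; exists n; repeat split; [apply agree_sym; exact H1| |]; destruct b, (x n), (y n); simpl; congruence.
Qed.

Lemma lex_lt_negb b x y : lex_lt b x y -> lex_lt (negb b) y x.
Proof.
  intros (n & H1 & H2 & H3); exists n; split; [apply agree_sym; exact H1|].
  rewrite H2, H3, Bool.negb_involutive; auto.
Qed.

Lemma lex_lt_glue b k x s t : lex_lt b s t -> lex_lt b (glue k x s) (glue k x t).
Proof.
  intros (n & H1 & H2 & H3). exists (k + n)%nat. split; [apply agree_glue_glue; exact H1|].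
  unfold glue; destruct (Nat.ltb_spec (k + n) k); [lia|].
  replace (k + n - k)%nat with n by lia; auto.
Qed.

Lemma lex_lt_glue_inv b k x s t : lex_lt b (glue k x s) (glue k x t) -> lex_lt b s t.
Proof.
  intros H. destruct (classic (s = t)) as [->|Hne].
  - exfalso; eapply lex_lt_irrefl; exact H.
  - destruct (lex_lt_total b _ _ Hne) as [|K]; [assumption|exfalso].
    apply (lex_lt_irrefl b (glue k x s)). eapply lex_lt_trans; [exact H|]. apply lex_lt_glue; exact K.
Qed.

(** Cones around the minimum are initial segments of the order. *)
Lemma lex_lt_near_min b k s t : lex_lt b s t -> agree k (const_seq b) t -> agree k (const_seq b) s.
Proof.
  intros (n & H1 & H2 & H3) H i Hi.
  assert (k <= n)%nat.
  { destruct (le_lt_dec k n); [assumption|]. specialize (H n l). unfold const_seq in H. rewrite H3 in H.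
    destruct b; discriminate. }
  rewrite H1 by lia; apply H; exact Hi.
Qed.

Lemma lex_lt_min b t : t <> const_seq b -> lex_lt b (const_seq b) t.
Proof.
  intros H. destruct (lex_lt_total b (const_seq b) t) as [|K]; [congruence|assumption|].
  destruct K as (n & H1 & H2 & H3). unfold const_seq in H3. destruct b; discriminate.
Qed.

(* Near a singularity [x = u b b b ...] with image [v b b b ...] the map is [u t |-> v h(t)]; commutation with [L_p] becomes commutation of [h] with [push b]. *)
Definition regular_data (f : Cantor -> Cantor) (x : Cantor) (b : bool) (N M : nat) (h : Cantor -> Cantor) : Prop :=
  x = glue N x (const_seq b) /\
  (forall t, f (glue N x t) = glue M (f x) (h t)) /\
  (forall t, h (push b t) = push b (h t)) /\
  (forall s t, lex_lt b s t -> lex_lt b (h s) (h t)).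

Definition regular (f : Cantor -> Cantor) (x : Cantor) : Prop := exists b N M h, regular_data f x b N M h.

(** The image is a fixed point of [push b], and the constant sequence is the only one. *)
Lemma equivariant_const_seq b (h : Cantor -> Cantor) :
  (forall t, h (push b t) = push b (h t)) -> h (const_seq b) = const_seq b.
Proof.
  intros H. assert (K : h (const_seq b) = push b (h (const_seq b))).
  { rewrite <- H; f_equal. apply functional_extensionality; intros [|i]; reflexivity. }
  apply functional_extensionality; intro i; induction i; rewrite K; simpl; [reflexivity|exact IHi].
Qed.

Lemma equivariant_glue b (h : Cantor -> Cantor) k t :
  (forall t, h (push b t) = push b (h t)) -> h (glue k (const_seq b) t) = glue k (const_seq b) (h t).
Proof.
  intros H; revert t; induction k; intro t.
  - replace (glue 0 (const_seq b) t) with t by seqext. seqext.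
  - replace (S k) with (k + 1)%nat by lia.
    rewrite <- !glue_const_seq_push, IHk, H; reflexivity.
Qed.

Lemma regular_data_image f x b N M h : regular_data f x b N M h -> f x = glue M (f x) (const_seq b).
Proof.
  intros (H1 & H2 & H3 & _). rewrite <- (equivariant_const_seq b h H3) at 1.
  rewrite <- H2, <- H1; reflexivity.
Qed.

Lemma glue_tail_const_seq N k x b t : x = glue N x (const_seq b) -> glue (N + k) x t = glue N x (glue k (const_seq b) t).
Proof. intros H. rewrite H at 1. apply glue_glue. Qed.

Lemma tail_const_seq_raise N k x b : x = glue N x (const_seq b) -> x = glue (N + k) x (const_seq b).
Proof.
  intros H. rewrite (glue_tail_const_seq _ _ _ _ _ H). rewrite H at 1. f_equal. seqext.
Qed.

Lemma regular_data_raise f x b N M h k : regular_data f x b N M h -> regular_data f x b (N + k) (M + k) h.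
Proof.
  intros H. pose proof (regular_data_image _ _ _ _ _ _ H) as Hi. destruct H as (H1 & H2 & H3 & H4).
  split; [apply tail_const_seq_raise; exact H1|]. split; [|split; assumption]. intro t.
  rewrite (glue_tail_const_seq _ _ _ _ _ H1), H2, equivariant_glue by exact H3.
  rewrite (glue_tail_const_seq _ _ _ _ _ Hi); reflexivity.
Qed.

Lemma prefix_map_regular_data f x b N M : x = glue N x (const_seq b) -> prefix_map f x N M -> regular_data f x b N M (fun t => t).
Proof. intros H K; repeat split; auto. Qed.

(** At a point with constant tail a prefix replacement is a regular germ with [h] the identity. This
    reduces mixed compositions to regular ones. *)
Lemma locally_linear_tail_regular f x b K : x = glue K x (const_seq b) -> locally_linear f x -> regular f x.
Proof.
  intros H [d (N & M & HP & _)]. exists b, (K + N)%nat, (M + K)%nat, (fun t => t).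
  apply prefix_map_regular_data; [apply tail_const_seq_raise; exact H|]. rewrite Nat.add_comm. apply prefix_map_raise; exact HP.
Qed.

Lemma tail_const_seq_unique x b b' N N' : x = glue N x (const_seq b) -> x = glue N' x (const_seq b') -> b = b'.
Proof.
  intros H H'. apply (f_equal (fun s => s (N + N')%nat)) in H; apply (f_equal (fun s => s (N + N')%nat)) in H'.
  unfold glue, const_seq in H, H'.
  destruct (Nat.ltb_spec (N + N') N); [lia|]. destruct (Nat.ltb_spec (N + N') N'); [lia|]. congruence.
Qed.

Lemma regular_comp f g x : regular f x -> regular g (f x) -> regular (fun y => g (f y)) x.
Proof.
  intros (b & N & M & h & H) (b' & N' & M' & h' & H').
  assert (b' = b) as ->.
  { eapply tail_const_seq_unique; [apply H'|eapply regular_data_image; exact H]. }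
  apply (regular_data_raise _ _ _ _ _ _ N') in H. apply (regular_data_raise _ _ _ _ _ _ M) in H'.
  rewrite (Nat.add_comm N' M) in H'.
  exists b, (N + N')%nat, (M' + M)%nat, (fun t => h' (h t)).
  destruct H as (H1 & H2 & H3 & H4), H' as (K1 & K2 & K3 & K4).
  split; [exact H1|]. split; [|split]; intros.
  - rewrite H2, K2; reflexivity.
  - rewrite H3, K3; reflexivity.
  - auto.
Qed.

(** In the mixed cases the linear germ also sits at a point with constant tail, because prefix
    replacements preserve tails; hence it is regular as well. *)
Lemma germ_comp f g x :
  locally_linear f x \/ regular f x -> locally_linear g (f x) \/ regular g (f x) -> locally_linear (fun y => g (f y)) x \/ regular (fun y => g (f y)) x.
Proof.
  intros [H|H] [K|K].
  - left; apply locally_linear_comp; assumption.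
  - right. destruct K as (b & N & M & h & K).
    assert (Hx : exists N', x = glue N' x (const_seq b)).
    { destruct H as [d (N0 & M0 & HP & _)]. exists (N0 + N)%nat.
      rewrite glue_add. rewrite <- (glue_drop N0 x) at 1. f_equal.
      pose proof (prefix_map_tail _ _ _ _ HP) as Ht. rewrite Ht.
      destruct K as (K1 & _). pose proof (tail_const_seq_raise _ M0 _ _ K1) as K2.
      rewrite Nat.add_comm in K2. rewrite glue_add in K2.
      rewrite K2 at 1. rewrite drop_glue; reflexivity. }
    destruct Hx as [N' Hx]. apply regular_comp; [eapply locally_linear_tail_regular; eauto|].
    exists b, N, M, h; exact K.
  - right. destruct H as (b & N & M & h & H). apply regular_comp; [exists b, N, M, h; exact H|].
    eapply locally_linear_tail_regular; [eapply regular_data_image; exact H|exact K].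
  - right; apply regular_comp; assumption.
Qed.

Lemma regular_data_cantor_continuous f x b N M h : regular_data f x b N M h ->
  forall k y, agree (N + k) x y -> agree (M + k) (f x) (f y).
Proof.
  intros H k y Hy. apply (regular_data_raise _ _ _ _ _ _ k) in H. destruct H as (_ & H2 & _).
  rewrite (agree_glue_eq _ _ _ Hy), H2. apply agree_glue.
Qed.

Lemma germs_cantor_continuous f : (forall x, locally_linear f x \/ regular f x) -> cantor_continuous f.
Proof.
  intros H x K. destruct (H x) as [HL|(b & N & M & h & HR)].
  - apply locally_linear_cantor_continuous; exact HL.
  - exists (N + K)%nat; intros y Hy.
    eapply agree_le; [|eapply regular_data_cantor_continuous; eauto]; lia.
Qed.

(** The image of the cone at [x] need not be a cone. Continuity of [fi] supplies a cone at [f x]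
    which [fi] sends into the cone at [x]; on it the inverse germ is the inverse of [h] preceded by
    the insertion of [K] digits [b]. *)
Lemma regular_inv f fi x : inv_pair f fi -> cantor_continuous fi -> regular f x -> regular fi (f x).
Proof.
  intros [Hp1 Hp2] Hc (b & N & M & h & H). pose proof (regular_data_image _ _ _ _ _ _ H) as Hi.
  destruct H as (H1 & H2 & H3 & H4).
  destruct (Hc (f x) N) as [K HK]. rewrite Hp1 in HK.
  set (h' := fun t => drop N (fi (glue (M + K) (f x) t))).
  assert (A : forall t, fi (glue (M + K) (f x) t) = glue N x (h' t)).
  { intro t; unfold h'. apply agree_glue_eq, HK. eapply agree_le; [|apply agree_glue]; lia. }
  assert (B : forall t, h (h' t) = glue K (const_seq b) t).
  { intro t; apply (glue_inj M (f x)). rewrite <- H2, <- A, Hp2. apply glue_tail_const_seq; exact Hi. }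
  assert (Inj : forall s t, h s = h t -> s = t).
  { intros s t Hst. apply (glue_inj N x). rewrite <- (Hp1 (glue N x s)), <- (Hp1 (glue N x t)), !H2, Hst; reflexivity. }
  exists b, (M + K)%nat, N, h'. split; [apply tail_const_seq_raise; exact Hi|].
  rewrite Hp1. split; [exact A|]. split.
  - intro t. apply Inj. rewrite H3, !B, push_glue_const_seq; reflexivity.
  - intros s t Hst. assert (Hh : lex_lt b (h (h' s)) (h (h' t))) by (rewrite !B; apply lex_lt_glue; exact Hst).
    destruct (classic (h' s = h' t)) as [E|E].
    + rewrite E in Hh; exfalso; eapply lex_lt_irrefl; exact Hh.
    + destruct (lex_lt_total b _ _ E) as [|Hlt]; [assumption|exfalso].
      apply H4 in Hlt. eapply lex_lt_irrefl, lex_lt_trans; eauto.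
Qed.

(* The list [E] may be larger than the set of singularities, which keeps this class closed under composition. *)
Definition tame (f : Cantor -> Cantor) : Prop :=
  (exists fi, inv_pair f fi) /\
  (exists E, forall x, ~ In x E -> locally_linear f x) /\
  (forall x, locally_linear f x \/ regular f x).

Lemma tame_cantor_continuous f : tame f -> cantor_continuous f.
Proof. intros (_ & _ & H); apply germs_cantor_continuous; exact H. Qed.

Lemma tame_id : tame (fun x => x).
Proof.
  split; [exists (fun x => x); split; reflexivity|]. split.
  - exists nil; intros; apply locally_linear_id.
  - left; apply locally_linear_id.
Qed.

Lemma tame_comp f g : tame f -> tame g -> tame (fun x => g (f x)).
Proof.
  intros ([fi Hf] & [E HE] & Hf3) ([gi Hg] & [E' HE'] & Hg3). split; [|split].
  - exists (fun x => fi (gi x)). destruct Hf as [A B], Hg as [C D].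
    split; intro x; [rewrite C, A|rewrite B, D]; reflexivity.
  - exists (E ++ map fi E'); intros x Hx. rewrite in_app_iff in Hx.
    apply locally_linear_comp; [apply HE; tauto|apply HE'].
    intro K; apply Hx; right. destruct Hf as [A _]. rewrite <- (A x); apply in_map; exact K.
  - intro x; apply germ_comp; auto.
Qed.

Lemma tame_inv f fi : inv_pair f fi -> tame f -> tame fi.
Proof.
  intros Hp HG. pose proof (cantor_continuous_inv _ _ Hp (tame_cantor_continuous _ HG)) as Hc.
  destruct HG as (_ & [E HE] & H). split; [exists f; apply inv_pair_sym; exact Hp|].
  pose proof Hp as [H1 H2]. split.
  - exists (map f E); intros x Hx. rewrite <- (H2 x). apply locally_linear_inv; [exact Hp|]. apply HE.
    intro K; apply Hx. rewrite <- (H2 x); apply in_map; exact K.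
  - intro x; rewrite <- (H2 x). destruct (H (fi x)) as [K|K].
    + left; apply locally_linear_inv; assumption.
    + right; apply regular_inv; assumption.
Qed.

Lemma tame_iter f n : tame f -> tame (Nat.iter n f).
Proof.
  intros H; induction n; [exact tame_id|]. apply (tame_comp (Nat.iter n f) f); assumption.
Qed.

Lemma cone_isolates (E : list Cantor) x : exists K, forall y, agree K x y -> In y E -> y = x.
Proof.
  induction E as [|e E [K HK]].
  - exists O; intros y _ [].
  - destruct (classic (e = x)) as [->|Hne].
    + exists K; intros y Hy [->|Hin]; auto.
    + destruct (neq_not_agree x e) as [n Hn]; [congruence|].
      exists (Nat.max K n); intros y Hy [->|Hin].
      * exfalso; apply Hn. eapply agree_le; [|exact Hy]; lia.
      * apply HK; [|exact Hin]. eapply agree_le; [|exact Hy]; lia.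
Qed.

Lemma glue_const_seq_decompose b t : t <> const_seq b -> exists j s, t = glue j (const_seq b) (push (negb b) s).
Proof.
  intros H. destruct (lex_lt_min b t H) as (j & H1 & _ & H3).
  exists j, (drop (S j) t). rewrite (agree_glue_eq _ _ _ H1) at 1. f_equal.
  rewrite (push_head (drop j t)). unfold drop at 1. rewrite Nat.add_0_r, H3. f_equal.
  rewrite drop_drop; f_equal; lia.
Qed.

(** Where [f] is linear the slope is locally constant, so only cones around singularities need work.
    There infinitely many pieces may accumulate, but the scaling moves each of them to the compact
    set of tails beginning with [negb b], where compactness is applied a second time. *)
Lemma tame_bounded_by f : tame f -> exists A L, bounded_by f A L.
Proof.
  intros (_ & [E HE] & Hg).
  destruct (cantor_compact (fun n y => forall d, log_contraction f y d -> (Z.abs d <= Z.of_nat n)%Z)) as [L HL].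
  - intros n m x Hnm H d Hd; specialize (H d Hd); lia.
  - intro x. destruct (classic (locally_linear f x)) as [[d Hd]|Hn].
    { destruct (log_contraction_near _ _ _ Hd) as [N HN]. exists (Nat.max N (Z.to_nat (Z.abs d))).
      intros y Hy e He. assert (Hy' : log_contraction f y d) by (apply HN; eapply agree_le; [|exact Hy]; lia).
      rewrite <- (log_contraction_unique _ _ _ _ Hy' He). lia. }
    destruct (Hg x) as [?|(b & N0 & M0 & h & HR)]; [contradiction|].
    destruct (cone_isolates E x) as [K HK].
    apply (regular_data_raise _ _ _ _ _ _ K) in HR. set (N := (N0 + K)%nat) in *. set (M := (M0 + K)%nat) in *.
    pose proof (regular_data_image _ _ _ _ _ _ HR) as Hi.
    destruct HR as (H1 & H2 & H3 & _).
    set (y0 := fun t => glue N x (push (negb b) t)).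
    assert (HLL : forall t, locally_linear f (y0 t)).
    { intro t; apply HE; intro Hin. apply HK in Hin.
      - unfold y0 in Hin. rewrite H1 in Hin at 2. apply glue_inj in Hin.
        apply (f_equal (fun s => s O)) in Hin. unfold const_seq in Hin; simpl in Hin. destruct b; discriminate.
      - eapply agree_le; [|apply agree_glue]; unfold N; lia. }
    destruct (cantor_compact (fun n t => forall d, log_contraction f (y0 t) d -> (Z.abs d <= Z.of_nat n)%Z)) as [L HL].
    + intros n m t Hnm H d Hd; specialize (H d Hd); lia.
    + intro t. destruct (HLL t) as [d Hd]. destruct (log_contraction_near _ _ _ Hd) as [k Hk].
      exists (Nat.max k (Z.to_nat (Z.abs d))). intros s Hs e He.
      assert (Hs' : log_contraction f (y0 s) d).
      { apply Hk. unfold y0; rewrite !push_glue.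
        apply (agree_le _ (N + (1 + k))); [lia|]. apply agree_glue_glue, agree_glue_glue.
        eapply agree_le; [|exact Hs]; lia. }
      rewrite <- (log_contraction_unique _ _ _ _ Hs' He). lia.
    + exists (Nat.max N L). intros y Hy d Hd.
      assert (Hyx : y <> x) by (intros ->; apply Hn; exists d; exact Hd).
      assert (Hy1 : y = glue N x (drop N y)) by (apply agree_glue_eq; eapply agree_le; [|exact Hy]; lia).
      destruct (glue_const_seq_decompose b (drop N y)) as (j & s & Hs).
      { intro K1; apply Hyx. rewrite Hy1, K1; symmetry; exact H1. }
      rewrite Hs in Hy1. subst y.
      (* Conjugating by the [j]-th power of the scaling moves the point to the fundamental domain [y0] without changing its slope. *)
      set (a := fun w => glue N x (glue j (const_seq b) (drop N w))).
      set (c := fun w => glue M (f x) (drop (M + j) w)).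
      assert (Ha : prefix_map a (y0 s) N (N + j)).
      { intro t. unfold a. rewrite drop_glue, glue_glue, glue_glue_same; reflexivity. }
      assert (Hay : a (y0 s) = glue N x (glue j (const_seq b) (push (negb b) s))).
      { unfold a, y0. rewrite drop_glue; reflexivity. }
      assert (Hfy : f (glue N x (glue j (const_seq b) (push (negb b) s))) =
                    glue (M + j) (f x) (h (push (negb b) s))).
      { rewrite H2, equivariant_glue by exact H3. rewrite (glue_tail_const_seq M j _ b) by exact Hi; reflexivity. }
      assert (Hc : prefix_map c (f (glue N x (glue j (const_seq b) (push (negb b) s)))) (M + j) M).
      { rewrite Hfy. intro t. unfold c. rewrite !drop_glue, glue_glue_same; reflexivity. }
      assert (Hcomp : log_contraction (fun w => c (f (a w))) (y0 s)
        ((Z.of_nat (N + j) - Z.of_nat N) + d + (Z.of_nat M - Z.of_nat (M + j)))).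
      { apply (log_contraction_comp (fun w => f (a w)) c).
        - apply log_contraction_comp; [apply prefix_map_log_contraction; exact Ha|]. rewrite Hay; exact Hd.
        - rewrite Hay. apply prefix_map_log_contraction; exact Hc. }
      replace (_ + d + _)%Z with d in Hcomp by lia.
      assert (Hfs : log_contraction f (y0 s) d).
      { apply (log_contraction_ext (fun w => c (f (a w))) f _ _ N); [|exact Hcomp].
        intros w Hw. unfold a.
        assert (Hw' : w = glue N x (drop N w)).
        { apply agree_glue_eq. eapply agree_trans; [|exact Hw]. apply agree_glue. }
        rewrite H2, equivariant_glue by exact H3. unfold c. rewrite <- (glue_tail_const_seq M j _ b) by exact Hi.
        rewrite drop_glue. rewrite Hw' at 2. symmetry; apply H2. }
      specialize (HL _ _ Hfs). lia.
  - exists (length E), L, E; split; [lia|]. intros x Hx.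
    destruct (HE x Hx) as [d Hd]. exists d; split; [exact Hd|]. apply (HL x); exact Hd.
Qed.

(** * Labels of points; the groups [V] and [\hat A] *)

Lemma phi_summable (x : Cantor) : ex_series (fun n => if x n then / 2 ^ (S n) else 0).
Proof.
  apply (ex_series_le (K := R_AbsRing) (V := R_CompleteNormedModule) _ (fun n => (/ 2) ^ n)).
  - intro n. assert (0 < / 2 ^ n) by (apply Rinv_0_lt_compat, pow_lt; lra).
    rewrite pow_inv. destruct (x n); unfold norm; simpl; unfold abs; simpl.
    + rewrite Rabs_pos_eq; rewrite Rinv_mult; lra.
    + rewrite Rabs_R0; lra.
  - apply ex_series_geom. rewrite Rabs_pos_eq; lra.
Qed.

Lemma phi_step x : phi x = (if x O then / 2 else 0) + phi (drop 1 x) / 2.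
Proof.
  unfold phi at 1. rewrite Series_incr_1 by apply phi_summable. f_equal.
  - destruct (x O); [|reflexivity]. simpl; f_equal; lra.
  - unfold phi, Rdiv. rewrite Rmult_comm, <- Series_scal_l. apply Series_ext; intro n.
    unfold drop; simpl. destruct (x (S n)); [|ring].
    rewrite !Rinv_mult; ring.
Qed.

Lemma phi_const_seq_false : phi (const_seq false) = 0.
Proof.
  unfold phi, const_seq. rewrite (Series_ext _ (fun _ => 0 * 0)) by (intro; ring).
  rewrite Series_scal_l; ring.
Qed.

Lemma phi_bounds x : 0 <= phi x <= 1.
Proof.
  split.
  - rewrite <- phi_const_seq_false.
    apply Series_le; [|apply phi_summable]. intro n; unfold const_seq; split; [lra|].
    assert (0 < / 2 ^ S n) by (apply Rinv_0_lt_compat, pow_lt; lra). destruct (x n); lra.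
  - replace 1 with (/ 2 * Series (fun n => (/ 2) ^ n)).
    + rewrite <- Series_scal_l. apply Series_le.
      * intro n. assert (0 < / 2 ^ n) by (apply Rinv_0_lt_compat, pow_lt; lra).
        rewrite pow_inv. destruct (x n); simpl; rewrite ?Rinv_mult; lra.
      * apply (ex_series_scal_l (K := R_AbsRing) (/ 2) (fun n => (/ 2) ^ n)), ex_series_geom. rewrite Rabs_pos_eq; lra.
    + rewrite Series_geom; [lra|rewrite Rabs_pos_eq; lra].
Qed.

(** Besides computing labels, it numbers the prefixes of length [n] for the pigeonhole arguments. *)
Fixpoint valN (n : nat) (x : Cantor) : nat :=
  match n with O => O | S k => (2 * valN k x + Nat.b2n (x k))%nat end.

Lemma pow2_pos n : 0 < 2 ^ n.
Proof. apply pow_lt; lra. Qed.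

Lemma phi_prefix n x : phi x = (INR (valN n x) + phi (drop n x)) / 2 ^ n.
Proof.
  induction n.
  - simpl. replace (drop 0 x) with x by seqext. lra.
  - rewrite IHn, (phi_step (drop n x)), drop_drop.
    change (valN (S n) x) with (2 * valN n x + Nat.b2n (x n))%nat.
    rewrite plus_INR, mult_INR. unfold drop at 1. rewrite Nat.add_0_r.
    replace (n + 1)%nat with (S n) by lia. pose proof (pow2_pos n).
    simpl pow. simpl (INR 2). destruct (x n); simpl (INR (Nat.b2n _)); field; lra.
Qed.

Lemma valN_agree n x y : agree n x y -> valN n x = valN n y.
Proof.
  induction n; intro H; simpl; [reflexivity|].
  rewrite IHn by (eapply agree_le; [|exact H]; lia). rewrite (H n) by lia; reflexivity.
Qed.

Lemma valN_agree_inv n x y : valN n x = valN n y -> agree n x y.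
Proof.
  induction n; intros H i Hi; [lia|]. simpl in H.
  assert (valN n x = valN n y /\ x n = y n) as [H1 H2].
  { destruct (x n), (y n); simpl in H; split; solve [reflexivity | lia]. }
  destruct (Nat.eq_dec i n) as [->|]; [exact H2|apply IHn; [exact H1|lia]].
Qed.

Lemma valN_lt n x : (valN n x < 2 ^ n)%nat.
Proof. induction n; simpl; [lia|]. destruct (x n); simpl; lia. Qed.

Lemma valN_surj n j : (j < 2 ^ n)%nat -> exists x, valN n x = j.
Proof.
  revert j; induction n; intros j Hj; simpl in *.
  - exists (const_seq true); lia.
  - pose proof (Nat.div_mod j 2 ltac:(lia)). pose proof (Nat.mod_upper_bound j 2 ltac:(lia)).
    destruct (IHn (j / 2)%nat) as [x Hx]; [lia|].
    exists (glue n x (const_seq (Nat.odd j))).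
    rewrite <- (valN_agree n x) by apply agree_glue. unfold glue, const_seq. rewrite Nat.ltb_irrefl, Hx.
    pose proof (Nat.div2_odd j). rewrite Nat.div2_div in H1. lia.
Qed.

Lemma phi_glue n x t : phi (glue n x t) = (INR (valN n x) + phi t) / 2 ^ n.
Proof.
  rewrite (phi_prefix n), drop_glue, (valN_agree n _ x); [reflexivity|].
  apply agree_sym, agree_glue.
Qed.

Lemma phi_push b t : phi (push b t) = (if b then / 2 else 0) + phi t / 2.
Proof. rewrite phi_step; reflexivity. Qed.

Lemma phi_zero x : phi x = 0 -> x = const_seq false.
Proof.
  intros H. apply functional_extensionality; intro i. unfold const_seq. revert x H; induction i; intros x H.
  - rewrite phi_step in H. pose proof (phi_bounds (drop 1 x)). destruct (x O); [lra|reflexivity].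
  - apply (IHi (drop 1 x)). rewrite phi_step in H. pose proof (phi_bounds (drop 1 x)).
    destruct (x O); lra.
Qed.

Lemma phi_one x : phi x = 1 -> x = const_seq true.
Proof.
  intros H. apply functional_extensionality; intro i. unfold const_seq. revert x H; induction i; intros x H.
  - rewrite phi_step in H. pose proof (phi_bounds (drop 1 x)). destruct (x O); [reflexivity|lra].
  - apply (IHi (drop 1 x)). rewrite phi_step in H. pose proof (phi_bounds (drop 1 x)).
    destruct (x O); lra.
Qed.

Lemma phi_const_seq_true : phi (const_seq true) = 1.
Proof. pose proof (phi_step (const_seq true)) as H. rewrite drop_const_seq in H. unfold const_seq in H at 2. lra. Qed.

(** Labels can coincide only if the tails behind the first difference are all ones and all zeros
    respectively, that is, for the two preimages of a dyadic number. *)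
Lemma lex_lt_phi x y : lex_lt false x y -> phi x <= phi y /\ (phi x = phi y -> ev1 x /\ ~ ev1 y).
Proof.
  intros (n & H1 & H2 & H3).
  assert (Hx : x = glue n x (push false (drop (n + 1) x))).
  { rewrite <- (glue_drop n x) at 1. f_equal. rewrite (push_head (drop n x)), drop_drop.
    unfold drop at 1; rewrite Nat.add_0_r, H2; reflexivity. }
  assert (Hy : y = glue n x (push true (drop (n + 1) y))).
  { rewrite (agree_glue_eq _ _ _ H1) at 1. f_equal. rewrite (push_head (drop n y)), drop_drop.
    unfold drop at 1; rewrite Nat.add_0_r, H3; reflexivity. }
  assert (Ex : phi x = (INR (valN n x) + phi (drop (n + 1) x) / 2) / 2 ^ n).
  { rewrite Hx at 1. rewrite phi_glue, phi_push. f_equal; lra. }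
  assert (Ey : phi y = (INR (valN n x) + / 2 + phi (drop (n + 1) y) / 2) / 2 ^ n).
  { rewrite Hy at 1. rewrite phi_glue, phi_push. f_equal; lra. }
  pose proof (phi_bounds (drop (n + 1) x)) as Bx. pose proof (phi_bounds (drop (n + 1) y)) as By.
  pose proof (pow2_pos n) as Hp. assert (Hq : 0 < / 2 ^ n) by (apply Rinv_0_lt_compat; exact Hp).
  rewrite Ex, Ey. split.
  - unfold Rdiv at 1 3. apply Rmult_le_compat_r; lra.
  - intro E. unfold Rdiv at 1 3 in E. apply Rmult_eq_reg_r in E; [|lra].
    assert (S1 : drop (n + 1) x = const_seq true) by (apply phi_one; lra).
    assert (S2 : drop (n + 1) y = const_seq false) by (apply phi_zero; lra).
    split.
    + exists (n + 1)%nat; intros i Hi. replace i with (n + 1 + (i - (n + 1)))%nat by lia.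
      change (drop (n + 1) x (i - (n + 1))%nat = true). rewrite S1; reflexivity.
    + intros [N HN]. specialize (HN (n + 1 + N)%nat ltac:(lia)).
      change (drop (n + 1) y N = true) in HN. rewrite S2 in HN; discriminate.
Qed.

Lemma phi_inj x y : phi x = phi y -> (ev1 x <-> ev1 y) -> x = y.
Proof.
  intros H K. apply NNPP; intro Hne.
  destruct (lex_lt_total false _ _ Hne) as [L|L]; apply lex_lt_phi in L; destruct L as [_ L].
  - destruct (L H); tauto.
  - destruct (L (eq_sym H)); tauto.
Qed.

(** The part of the label that remains after [n] digits is an integer between 0 and 1, and each of
    the labels 0 and 1 has a single preimage. *)
Lemma dyadic_phi x : dyadic (phi x) -> ev0 x \/ ev1 x.
Proof.
  intros (m & n & H). rewrite (phi_prefix n) in H. pose proof (pow2_pos n) as Hp.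
  assert (E : phi (drop n x) = IZR (m - Z.of_nat (valN n x))).
  { rewrite minus_IZR, <- INR_IZR_INZ. unfold Rdiv in H. apply Rmult_eq_reg_r in H; [lra|].
    apply Rinv_neq_0_compat; lra. }
  pose proof (phi_bounds (drop n x)) as Hb. rewrite E in Hb.
  destruct Hb as [B1 B2]. apply le_IZR in B1; apply le_IZR in B2.
  assert (C : (m - Z.of_nat (valN n x) = 0 \/ m - Z.of_nat (valN n x) = 1)%Z) by lia.
  assert (D : exists b, drop n x = const_seq b).
  { destruct C as [C|C]; rewrite C in E; [exists false; apply phi_zero|exists true; apply phi_one]; exact E. }
  destruct D as [b D].
  assert (F : forall i, (n <= i)%nat -> x i = b).
  { intros i Hi. replace i with (n + (i - n))%nat by lia.
    change (drop n x (i - n)%nat = b). rewrite D; reflexivity. }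
  destruct b; [right|left]; exists n; exact F.
Qed.

Lemma ev0_not_ev1 x : ev0 x -> ~ ev1 x.
Proof.
  intros [N H] [M K]. specialize (H (N + M)%nat ltac:(lia)). specialize (K (N + M)%nat ltac:(lia)). congruence.
Qed.

Lemma ev0_glue x : ev0 x -> exists N, x = glue N x (const_seq false).
Proof.
  intros [N H]; exists N. apply functional_extensionality; intro i. unfold glue, const_seq.
  destruct (Nat.ltb_spec i N); auto.
Qed.

Lemma ev1_glue x : ev1 x -> exists N, x = glue N x (const_seq true).
Proof.
  intros [N H]; exists N. apply functional_extensionality; intro i. unfold glue, const_seq.
  destruct (Nat.ltb_spec i N); auto.
Qed.

Lemma phi_agree n x y : agree n x y -> Rabs (phi x - phi y) <= / 2 ^ n.
Proof.
  intros H. rewrite (phi_prefix n x), (phi_prefix n y), (valN_agree _ _ _ H).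
  pose proof (phi_bounds (drop n x)). pose proof (phi_bounds (drop n y)).
  assert (0 < / 2 ^ n) by (apply Rinv_0_lt_compat, pow2_pos).
  unfold Rdiv. rewrite <- Rmult_minus_distr_r, Rabs_mult, (Rabs_pos_eq (/ 2 ^ n)) by lra.
  rewrite <- (Rmult_1_l (/ 2 ^ n)) at 2. apply Rmult_le_compat_r; [lra|].
  apply Rabs_le; lra.
Qed.

Lemma small_pow2 eps : 0 < eps -> exists n, / 2 ^ n < eps.
Proof.
  intros H. destruct (pow_lt_1_zero (/ 2)) with (y := eps) as [n Hn].
  - rewrite Rabs_pos_eq; lra.
  - exact H.
  - exists n. specialize (Hn n (Nat.le_refl n)). rewrite pow_inv, Rabs_pos_eq in Hn; [exact Hn|].
    left; apply Rinv_0_lt_compat, pow2_pos.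
Qed.

Lemma small_pow2_le eps : 0 < eps -> exists n, forall m, (n <= m)%nat -> / 2 ^ m < eps.
Proof.
  intros H. destruct (small_pow2 _ H) as [n Hn]. exists n; intros m Hm.
  apply Rle_lt_trans with (/ 2 ^ n); [|exact Hn].
  apply Rinv_le_contravar; [apply pow2_pos|]. apply Rle_pow; [lra|exact Hm].
Qed.

(** At a dyadic endpoint, only the preimage on the inner side belongs to the piece, and a small cone
    around that preimage stays on the inner side. *)
Lemma inPiece_open a b x : dyadic a -> dyadic b -> inPiece a b x ->
  exists N, forall y, agree N x y -> inPiece a b y.
Proof.
  intros Ha Hb ((H1 & H2) & H3 & H4).
  assert (L : exists N, forall y, agree N x y -> a <= phi y /\ ~ (phi y = a /\ ev1 y)).
  { destruct (Rle_lt_or_eq_dec _ _ H1) as [H|H].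
    - destruct (small_pow2 (phi x - a)) as [N HN]; [lra|].
      exists N; intros y Hy. apply phi_agree in Hy. apply Rabs_le_between in Hy. split; lra.
    - destruct (dyadic_phi x) as [E|E]; [congruence| |exfalso; auto].
      destruct (ev0_glue _ E) as [N HN]. exists N; intros y Hy.
      rewrite (agree_glue_eq _ _ _ Hy). rewrite H, HN, !phi_glue, phi_const_seq_false, glue_glue_same.
      assert (0 < / 2 ^ N) by (apply Rinv_0_lt_compat, pow2_pos).
      set (t := drop N y). pose proof (phi_bounds t). unfold Rdiv.
      rewrite (valN_agree N (glue N x (const_seq false)) x) by (apply agree_sym, agree_glue). split.
      + apply Rmult_le_compat_r; lra.
      + intros [K1 K2]. apply Rmult_eq_reg_r in K1; [|lra].
        assert (T : t = const_seq false) by (apply phi_zero; lra).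
        rewrite T, <- HN in K2. exact (ev0_not_ev1 _ E K2). }
  assert (U : exists N, forall y, agree N x y -> phi y <= b /\ ~ (phi y = b /\ ev0 y)).
  { destruct (Rle_lt_or_eq_dec _ _ H2) as [H|H].
    - destruct (small_pow2 (b - phi x)) as [N HN]; [lra|].
      exists N; intros y Hy. apply phi_agree in Hy. apply Rabs_le_between in Hy. split; lra.
    - destruct (dyadic_phi x) as [E|E]; [congruence|exfalso; auto|].
      destruct (ev1_glue _ E) as [N HN]. exists N; intros y Hy.
      rewrite (agree_glue_eq _ _ _ Hy). rewrite <- H, HN, !phi_glue, phi_const_seq_true, glue_glue_same.
      assert (0 < / 2 ^ N) by (apply Rinv_0_lt_compat, pow2_pos).
      set (t := drop N y). pose proof (phi_bounds t). unfold Rdiv.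
      rewrite (valN_agree N (glue N x (const_seq true)) x) by (apply agree_sym, agree_glue). split.
      + apply Rmult_le_compat_r; lra.
      + intros [K1 K2]. apply Rmult_eq_reg_r in K1; [|lra].
        assert (T : t = const_seq true) by (apply phi_one; lra).
        rewrite T, <- HN in K2. exact (ev0_not_ev1 _ K2 E). }
  destruct L as [N1 L], U as [N2 U]. exists (N1 + N2)%nat; intros y Hy.
  destruct (L y) as [L1 L2]; [eapply agree_le; [|exact Hy]; lia|].
  destruct (U y) as [U1 U2]; [eapply agree_le; [|exact Hy]; lia|].
  repeat split; assumption.
Qed.

Lemma pieces_cover n (a : nat -> R) x :
  (forall i, (i <= n)%nat -> dyadic (a i)) ->
  a O <= phi x <= a n -> ~ (phi x = a O /\ ev1 x) -> ~ (phi x = a n /\ ev0 x) ->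
  exists i, (i < n)%nat /\ inPiece (a i) (a (S i)) x.
Proof.
  intros Hd. induction n; intros [H1 H2] H3 H4.
  - exfalso. assert (E : phi x = a O) by lra.
    destruct (dyadic_phi x); [rewrite E; auto| |]; auto.
  - destruct (classic (phi x <= a n /\ ~ (phi x = a n /\ ev0 x))) as [[K1 K2]|K].
    + destruct IHn as [i [Hi Hp]]; auto. exists i; split; [lia|exact Hp].
    + exists n; split; [lia|]. assert (L : a n <= phi x) by (destruct (Rle_dec (a n) (phi x)); [assumption|exfalso; apply K; split; [lra|intros [? _]; lra]]).
      split; [lra|]. split; [|exact H4].
      intros [E E1]. apply K; split; [lra|]. intros [_ E0]. exact (ev0_not_ev1 _ E0 E1).
Qed.

Lemma powerRZ_ratio k N M : (Z.of_nat M + k = Z.of_nat N)%Z -> powerRZ 2 k = 2 ^ N / 2 ^ M.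
Proof.
  intros H. rewrite !pow_powerRZ, <- H, powerRZ_add by lra. field.
  apply powerRZ_NOR; lra.
Qed.

Lemma dyadic_sub a b : dyadic a -> dyadic b -> dyadic (a - b).
Proof.
  intros (m & n & ->) (m' & n' & ->).
  exists (m * 2 ^ Z.of_nat n' - m' * 2 ^ Z.of_nat n)%Z, (n + n')%nat.
  rewrite minus_IZR, !mult_IZR, <- !pow_IZR, pow_add.
  pose proof (pow2_pos n). pose proof (pow2_pos n'). field; lra.
Qed.

Lemma dyadic_scale k a : dyadic a -> dyadic (powerRZ 2 k * a).
Proof.
  intros (m & n & ->). 
  rewrite (powerRZ_ratio k (Z.to_nat (Z.max k 0)) (Z.to_nat (Z.max (- k) 0))) by lia.
  exists (m * 2 ^ Z.of_nat (Z.to_nat (Z.max k 0)))%Z, (n + Z.to_nat (Z.max (- k) 0))%nat.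
  rewrite mult_IZR, <- pow_IZR, pow_add.
  pose proof (pow2_pos n). pose proof (pow2_pos (Z.to_nat (Z.max (- k) 0))). field; lra.
Qed.

(** An affine map with dyadic data carries a sufficiently small dyadic interval onto a dyadic
    interval; preservation of [ev1] then lifts this from labels to sequences. *)
Lemma affine_locally_linear g x N0 beta k : dyadic beta ->
  (forall y, agree N0 x y -> phi (g y) = beta + powerRZ 2 k * phi y /\ (ev1 (g y) <-> ev1 y)) ->
  locally_linear g x.
Proof.
  intros (m & r & Hb) H.
  (* This depth ensures that [N - k] is at least [r], so [beta * 2 ^ M] is an integer and the image
     interval has an integer index [j] at level [M]. *)
  set (N := (N0 + r + Z.to_nat (Z.abs k))%nat). set (M := Z.to_nat (Z.of_nat N - k)).
  assert (HM : (Z.of_nat M + k = Z.of_nat N)%Z) by (unfold M, N; lia).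
  set (j := (m * 2 ^ Z.of_nat (M - r) + Z.of_nat (valN N x))%Z).
  assert (HMr : (r <= M)%nat) by (unfold M, N; lia).
  pose proof (pow2_pos N) as PN. pose proof (pow2_pos M) as PM. pose proof (pow2_pos r) as Pr.
  assert (Hg : forall t, phi (g (glue N x t)) = (IZR j + phi t) / 2 ^ M).
  { intro t. destruct (H (glue N x t)) as [E _].
    { eapply agree_le; [|apply agree_glue]; unfold N; lia. }
    rewrite E, phi_glue, Hb, (powerRZ_ratio k N M HM). unfold j.
    rewrite plus_IZR, mult_IZR, <- pow_IZR, <- INR_IZR_INZ.
    replace (2 ^ M) with (2 ^ r * 2 ^ (M - r)) by (rewrite <- pow_add; f_equal; lia).
    pose proof (pow2_pos (M - r)). field; lra. }
  (* The images of the two extreme tails have labels in [0,1], which forces [j] to be the number of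
     an actual prefix of length [M]. *)
  assert (Hj0 : (0 <= j)%Z).
  { apply le_IZR. pose proof (Hg (const_seq false)) as E. rewrite phi_const_seq_false in E.
    pose proof (phi_bounds (g (glue N x (const_seq false)))) as B. rewrite E in B. destruct B as [B _].
    apply (Rmult_le_compat_r (2 ^ M)) in B; [|lra]. unfold Rdiv in B.
    rewrite Rmult_assoc, Rinv_l in B by lra. lra. }
  assert (Hj1 : (j < 2 ^ Z.of_nat M)%Z).
  { apply Z.lt_le_trans with (j + 1)%Z; [lia|]. apply le_IZR. rewrite plus_IZR, <- pow_IZR.
    pose proof (Hg (const_seq true)) as E. rewrite phi_const_seq_true in E.
    pose proof (phi_bounds (g (glue N x (const_seq true)))) as B. rewrite E in B. destruct B as [_ B].
    apply (Rmult_le_compat_r (2 ^ M)) in B; [|lra]. unfold Rdiv in B.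
    rewrite Rmult_assoc, Rinv_l in B by lra. lra. }
  destruct (valN_surj M (Z.to_nat j)) as [z Hz].
  { apply Nat2Z.inj_lt. rewrite Nat2Z.inj_pow, Z2Nat.id by lia. exact Hj1. }
  assert (Hgz : forall t, g (glue N x t) = glue M z t).
  { intro t. apply phi_inj.
    - rewrite Hg, phi_glue, Hz, INR_IZR_INZ, Z2Nat.id by lia. reflexivity.
    - destruct (H (glue N x t)) as [_ E].
      { eapply agree_le; [|apply agree_glue]; unfold N; lia. }
      rewrite E. assert (T : forall n u, ev1 (glue n u t) <-> ev1 t).
      { intros n u; split; intros [p Hp].
        - exists p; intros i Hi. specialize (Hp (n + i)%nat ltac:(lia)). unfold glue in Hp.
          destruct (Nat.ltb_spec (n + i) n); [lia|]. rewrite <- Hp; f_equal; lia.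
        - exists (n + p)%nat; intros i Hi. unfold glue. destruct (Nat.ltb_spec i n); [lia|]. apply Hp; lia. }
      rewrite !T; reflexivity. }
  exists (Z.of_nat M - Z.of_nat N)%Z. apply prefix_map_log_contraction. intro t. rewrite Hgz.
  rewrite <- (glue_drop N x) at 1. rewrite Hgz, glue_glue_same; reflexivity.
Qed.

(** * Generators of both kinds are tame *)

Lemma bijective_inv_pair f : bijective f -> exists fi, inv_pair f fi.
Proof.
  intros [H1 H2]. exists (fun y => proj1_sig (constructive_indefinite_description _ (H2 y))).
  assert (K : forall y, f (proj1_sig (constructive_indefinite_description _ (H2 y))) = y).
  { intro y; destruct (constructive_indefinite_description _ (H2 y)); assumption. }
  split; [|exact K]. intro x; apply H1, K.
Qed.

Lemma inV_tame f : inV f -> tame f.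
Proof.
  intros (Hb & n & a & b & k & Ha0 & Han & _ & Hda & Hdb & Hf).
  assert (HLL : forall x, locally_linear f x).
  { intro x. pose proof (phi_bounds x) as Bx.
    destruct (pieces_cover n a x Hda) as (i & Hi & Hp).
    - lra.
    - rewrite Ha0; intros [E E1]. apply phi_zero in E; subst x. destruct E1 as [N E1].
      specialize (E1 N (Nat.le_refl N)); discriminate.
    - rewrite Han; intros [E E1]. apply phi_one in E; subst x. destruct E1 as [N E1].
      specialize (E1 N (Nat.le_refl N)); discriminate.
    - destruct (inPiece_open _ _ _ (Hda i ltac:(lia)) (Hda (S i) ltac:(lia)) Hp) as [N HN].
      apply (affine_locally_linear f x N (b i - powerRZ 2 (k i) * a i) (k i)).
      + apply dyadic_sub; [auto|]. apply dyadic_scale, Hda; lia.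
      + intros y Hy. destruct (Hf i Hi y (HN y Hy)) as [E1 E2]. split; [rewrite E1; ring|exact E2]. }
  split; [apply bijective_inv_pair; exact Hb|]. split; [exists nil|]; auto.
Qed.

Lemma piecewise_increasing (F : R -> R) n (a : nat -> R) (s : nat -> Z) :
  (forall i, (i < n)%nat -> a i < a (S i)) ->
  (forall i, (i < n)%nat -> forall x, a i <= x <= a (S i) -> F x = F (a i) + powerRZ 2 (s i) * (x - a i)) ->
  forall x y, a O <= x -> x < y -> y <= a n -> F x < F y.
Proof.
  intros Ha HF. induction n; intros x y H1 H2 H3; [lra|].
  assert (Hl : forall u v, a n <= u -> u < v -> v <= a (S n) -> F u < F v).
  { intros u v K1 K2 K3. rewrite (HF n (Nat.lt_succ_diag_r n) u), (HF n (Nat.lt_succ_diag_r n) v) by lra.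
    assert (0 < powerRZ 2 (s n)) by (apply powerRZ_lt; lra).
    apply Rplus_lt_compat_l, Rmult_lt_compat_l; lra. }
  destruct (Rle_lt_dec y (a n)) as [K|K].
  - apply IHn; auto.
  - destruct (Rle_lt_dec (a n) x) as [L|L].
    + apply Hl; assumption.
    + apply Rlt_trans with (F (a n)); [apply IHn; auto; lra|apply Hl; lra].
Qed.

Lemma dyadic_inv_pow n : dyadic (/ 2 ^ n).
Proof. exists 1%Z, n. lra. Qed.

Lemma dyadic_window u v : 0 < u -> v < 1 ->
  exists d e, dyadic d /\ dyadic e /\ 0 < d /\ d < e /\ e < 1 /\ d < u /\ v < e.
Proof.
  intros Hu Hv. destruct (small_pow2_le u Hu) as [n Hn]. destruct (small_pow2_le (1 - v)) as [m Hm]; [lra|].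
  set (k := (n + m + 2)%nat). specialize (Hn k ltac:(unfold k; lia)). specialize (Hm k ltac:(unfold k; lia)).
  assert (Hk : / 2 ^ k < / 2).
  { apply Rinv_lt_contravar.
    - apply Rmult_lt_0_compat; [lra|apply pow2_pos].
    - rewrite <- (pow_1 2) at 1. apply Rlt_pow; [lra|unfold k; lia]. }
  assert (0 < / 2 ^ k) by (apply Rinv_0_lt_compat, pow2_pos).
  exists (/ 2 ^ k), (1 - / 2 ^ k). repeat split; try lra.
  - apply dyadic_inv_pow.
  - apply dyadic_sub; [exists 1%Z, O; simpl; lra|apply dyadic_inv_pow].
Qed.

(** Inside the open interval [F] is piecewise linear with positive slopes. At the ends, 0 and 1 are
    the extreme values, and injectivity makes the inequality strict. *)
Lemma isAhatF_increasing F : isAhatF F -> forall x y, 0 <= x -> x < y -> y <= 1 -> F x < F y.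
Proof.
  intros (H0 & H1 & Hr & Hi & _ & _ & HPL & _) x y Hx Hxy Hy.
  destruct (Rle_lt_or_eq_dec _ _ Hx) as [Hx'|Hx'].
  - destruct (Rle_lt_or_eq_dec _ _ Hy) as [Hy'|Hy'].
    + destruct (dyadic_window x y Hx' Hy') as (d & e & Hd & He & D1 & D2 & D3 & D4 & D5).
      destruct (HPL d e Hd He D1 D2 D3) as (n & a & s & A0 & An & A1 & _ & A3).
      apply (piecewise_increasing F n a s); auto; lra.
    + subst y. rewrite H1. destruct (Hr x) as [_ B]; [lra|].
      destruct (Rle_lt_or_eq_dec _ _ B) as [|E]; [assumption|].
      rewrite <- H1 in E. apply Hi in E; lra.
  - subst x. rewrite H0. destruct (Hr y) as [B _]; [lra|].
    destruct (Rle_lt_or_eq_dec _ _ B) as [|E]; [assumption|].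
    rewrite <- H0 in E. apply Hi in E; lra.
Qed.

Lemma ev1_push b t : ev1 (push b t) <-> ev1 t.
Proof.
  split; intros [N H].
  - exists N; intros i Hi. apply (H (S i)); lia.
  - exists (S N); intros [|i] Hi; [lia|]. apply H; lia.
Qed.

Lemma inAhat_tame g : inAhat g -> tame g.
Proof.
  intros (Hb & F & HF & Hg). pose proof (isAhatF_increasing F HF) as Hinc.
  destruct HF as (H0 & H1 & Hr & Hi & _ & _ & HPL & HL & HR).
  (* The order on sequences refines that of labels; between two preimages of one label it is decided
     by [ev1], which [g] preserves. *)
  assert (Hmono : forall x y, lex_lt false x y -> lex_lt false (g x) (g y)).
  { intros x y Hxy. destruct (classic (g x = g y)) as [E|E].
    - apply Hb in E; subst y. exfalso; exact (lex_lt_irrefl _ _ Hxy).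
    - destruct (lex_lt_total false _ _ E) as [|K]; [assumption|exfalso].
      destruct (lex_lt_phi _ _ Hxy) as [P1 P2]. destruct (lex_lt_phi _ _ K) as [Q1 Q2].
      destruct (Hg x) as [Gx Ex], (Hg y) as [Gy Ey].
      destruct (Rle_lt_or_eq_dec _ _ P1) as [P|P].
      + pose proof (phi_bounds x). pose proof (phi_bounds y).
        pose proof (Hinc (phi x) (phi y)). rewrite Gx, Gy in Q1. lra.
      + rewrite Gx, Gy, P in Q2. destruct (P2 P), (Q2 eq_refl). tauto. }
  assert (Hmono' : forall b x y, lex_lt b x y -> lex_lt b (g x) (g y)).
  { intros [] x y H; [|auto]. apply (lex_lt_negb false), Hmono, (lex_lt_negb true); exact H. }
  assert (HLL : forall x, x <> const_seq false -> x <> const_seq true -> locally_linear g x).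
  { intros x Hx0 Hx1. pose proof (phi_bounds x) as Bx.
    assert (B0 : 0 < phi x) by (destruct Bx as [[|E] _]; [assumption|exfalso; apply Hx0, phi_zero; auto]).
    assert (B1 : phi x < 1) by (destruct Bx as [_ [|E]]; [assumption|exfalso; apply Hx1, phi_one; auto]).
    destruct (dyadic_window _ _ B0 B1) as (d & e & Hd & He & D1 & D2 & D3 & D4 & D5).
    destruct (HPL d e Hd He D1 D2 D3) as (n & a & s & A0 & An & A1 & A2 & A3).
    destruct (pieces_cover n a x) as (i & Hin & Hp).
    - intros i Hin; apply A2; exact Hin.
    - lra.
    - intros [E _]; lra.
    - intros [E _]; lra.
    - destruct (A2 i) as [Di Fi]; [lia|]. destruct (A2 (S i)) as [Di' _]; [lia|].
      destruct (inPiece_open _ _ _ Di Di' Hp) as [N HN].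
      apply (affine_locally_linear g x N (F (a i) - powerRZ 2 (s i) * a i) (s i)).
      + apply dyadic_sub; [auto|]. apply dyadic_scale; auto.
      + intros y Hy. destruct (Hg y) as [E1 E2]. split; [|exact E2]. rewrite E1, (A3 i Hin).
        * ring. * apply HN; exact Hy. }
  assert (HReg : forall b, regular g (const_seq b)).
  { intro b.
    assert (Heq : exists N, forall t, g (push b (glue N (const_seq b) t)) = push b (g (glue N (const_seq b) t))).
    { destruct b.
      - destruct HR as (eps & He & HR). destruct (small_pow2 eps He) as [N HN]. exists N; intro t.
        set (y := glue N (const_seq true) t).
        assert (By : 1 - eps < phi y).
        { pose proof (phi_agree N (const_seq true) y (agree_glue _ _ _)) as A. rewrite phi_const_seq_true in A.
          apply Rabs_le_between in A. lra. }
        pose proof (phi_bounds y).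
        apply phi_inj.
        + rewrite (proj1 (Hg _)), !phi_push, (proj1 (Hg y)).
          pose proof (HR (/ 2 + phi y / 2) ltac:(lra)) as E.
          replace (2 * (/ 2 + phi y / 2) - 1) with (phi y) in E by field. lra.
        + rewrite (proj2 (Hg _)), !ev1_push, (proj2 (Hg _)). reflexivity.
      - destruct HL as (eps & He & HL). destruct (small_pow2 eps He) as [N HN]. exists N; intro t.
        set (y := glue N (const_seq false) t).
        assert (By : phi y < eps).
        { pose proof (phi_agree N (const_seq false) y (agree_glue _ _ _)) as A. rewrite phi_const_seq_false in A.
          apply Rabs_le_between in A. lra. }
        pose proof (phi_bounds y).
        apply phi_inj.
        + rewrite (proj1 (Hg _)), !phi_push, (proj1 (Hg y)).
          pose proof (HL (phi y / 2) ltac:(lra)) as E.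
          replace (2 * (phi y / 2)) with (phi y) in E by field.
          replace (0 + phi y / 2) with (phi y / 2) by lra. lra.
        + rewrite (proj2 (Hg _)), !ev1_push, (proj2 (Hg _)). reflexivity. }
    (* With an image prefix of length 0, the germ [h] is [g] itself read on the cone of depth
       [N]. *)
    destruct Heq as [N HN]. exists b, N, O, (fun t => g (glue N (const_seq b) t)).
    split; [seqext|]. split; [|split].
    - intro t; seqext. - intro t; rewrite <- push_glue_const_seq; apply HN.
    - intros s t Hst; apply Hmono', lex_lt_glue; exact Hst. }
  split; [apply bijective_inv_pair; exact Hb|]. split.
  - exists (const_seq false :: const_seq true :: nil); intros x Hx. simpl in Hx.
    apply HLL; intro; subst; tauto.
  - intro x. destruct (classic (x = const_seq false)) as [->|]; [right; auto|].
    destruct (classic (x = const_seq true)) as [->|]; [right; auto|left; auto].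
Qed.

(** * Words in the generators *)

Lemma represents_eq w g : represents w g -> evalw w g.
Proof.
  intros (g' & H & K). replace g with g'; [exact H|]. apply functional_extensionality; exact K.
Qed.

Lemma evalw_tame w g : (forall p, In p w -> tame (snd p)) -> evalw w g -> tame g.
Proof.
  intros H He. induction He as [|h w g He IH|h hi w g H1 H2 He IH].
  - exact tame_id.
  - apply (tame_comp h g); [apply (H (true, h)); left; reflexivity|].
    apply IH; intros p Hp; apply H; right; exact Hp.
  - apply (tame_comp hi g).
    + apply (tame_inv h); [split; assumption|]. apply (H (false, h)); left; reflexivity.
    + apply IH; intros p Hp; apply H; right; exact Hp.
Qed.

Lemma inVA_tame f : inVA f -> tame f.
Proof.
  intros (_ & w & Hw & Hr). apply represents_eq in Hr. apply (evalw_tame w); [|exact Hr].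
  intros p Hp; destruct (Hw p Hp); [apply inV_tame|apply inAhat_tame]; assumption.
Qed.

Lemma evalw_bounded_by K (G : list (Cantor -> Cantor)) w g :
  (forall s, In s G -> tame s /\ bounded_by s K K) -> wordOver G w -> evalw w g ->
  bounded_by g (K * length w) (K * length w).
Proof.
  intros HS Hw He. induction He as [|h w g He IH|h hi w g H1 H2 He IH].
  - rewrite Nat.mul_0_r; exact bounded_by_id.
  - destruct (HS h) as [[[hi Hp] _] HB]; [apply (Hw (true, h)); left; reflexivity|].
    simpl length. rewrite Nat.mul_succ_r, (Nat.add_comm _ K).
    apply (bounded_by_comp h hi g); [exact Hp|exact HB|].
    apply IH; intros p Hpw; apply Hw; right; exact Hpw.
  - destruct (HS h) as [_ HB]; [apply (Hw (false, h)); left; reflexivity|].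
    simpl length. rewrite Nat.mul_succ_r, (Nat.add_comm _ K).
    apply (bounded_by_comp hi h g); [split; assumption| |].
    + apply (bounded_by_inv h); [split; assumption|exact HB].
    + apply IH; intros p Hpw; apply Hw; right; exact Hpw.
Qed.

(** * Fixed singularities *)

(** The distance of the label from the label of [const_seq b], so that it is monotone for
    [lex_lt b]. *)
Definition oriented_phi (b : bool) (x : Cantor) : R := if b then 1 - phi x else phi x.

Lemma lex_lt_oriented_phi b x y : lex_lt b x y -> oriented_phi b x <= oriented_phi b y.
Proof.
  intros H; destruct b; unfold oriented_phi.
  - apply lex_lt_negb, lex_lt_phi in H. lra.
  - apply lex_lt_phi in H. tauto.
Qed.

Lemma oriented_phi_agree b n x y : agree n x y -> oriented_phi b y - oriented_phi b x <= / 2 ^ n.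
Proof.
  intros H. apply phi_agree in H. apply Rabs_le_between in H. destruct b; unfold oriented_phi; lra.
Qed.

Lemma oriented_phi_glue_length b n x :
  oriented_phi b (glue n x (const_seq (negb b))) - oriented_phi b (glue n x (const_seq b)) = / 2 ^ n.
Proof.
  pose proof (pow2_pos n).
  destruct b; unfold oriented_phi; simpl negb; rewrite !phi_glue, phi_const_seq_true, phi_const_seq_false; field; lra.
Qed.

Lemma pow2_succ_inv n : / 2 ^ S n = / 2 ^ n / 2.
Proof. simpl. pose proof (pow2_pos n). field; lra. Qed.

(* If the image were shorter, bisection would produce a point where it is too short for the local slope. *)
Lemma slope_of_contraction b G c0 p q L :
  (forall y, agree p c0 y -> exists d, log_contraction G y d /\ (Z.abs d <= Z.of_nat L)%Z) ->
  (forall y y', agree p c0 y -> agree p c0 y' -> lex_lt b y y' -> lex_lt b (G y) (G y')) ->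
  (forall y, agree p c0 y -> agree q (G c0) (G y)) ->
  (q <= p + L)%nat.
Proof.
  intros HL Hm Hq. destruct (le_lt_dec q (p + L)) as [|Hlt]; [assumption|exfalso].
  set (len := fun k y => oriented_phi b (G (glue k y (const_seq (negb b)))) - oriented_phi b (G (glue k y (const_seq b)))).
  (* The invariant says that the image of the cone is shorter than the cone by a factor
     [2 ^ (L + 1)], one factor 2 beyond what slopes of at least [2 ^ (-L)] permit. *)
  destruct (bisection (fun k y => (p <= k)%nat /\ agree p c0 y /\ len k y <= / 2 ^ (k + L + 1)) p c0) as [z [_ Hz]].
  - intros k x y Hxy (H1 & H2 & H3). split; [exact H1|]. split.
    + apply agree_trans with x; [exact H2|]. eapply agree_le; eauto.
    + unfold len in *. rewrite <- !(glue_agree k x y) by exact Hxy. exact H3.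
  - split; [lia|]. split; [apply agree_refl|]. unfold len.
    apply Rle_trans with (/ 2 ^ q).
    + apply oriented_phi_agree. apply agree_trans with (G c0); [apply agree_sym|]; apply Hq, agree_glue.
    + apply Rinv_le_contravar; [apply pow2_pos|]. apply Rle_pow; [lra|lia].
  - intros k y Hk (_ & Hy & Hlen).
    set (y0 := glue k y (const_seq b)). set (y1 := glue k y (const_seq (negb b))).
    assert (Hck : forall w, agree k y w -> agree p c0 w).
    { intros w Hw. apply agree_trans with y; [exact Hy|]. eapply agree_le; eauto. }
    assert (E0 : glue (S k) y0 (const_seq b) = y0) by (unfold y0; seqext).
    assert (E1 : glue (S k) y1 (const_seq (negb b)) = y1) by (unfold y1; seqext).
    assert (Hmid : oriented_phi b (G (glue (S k) y0 (const_seq (negb b)))) <= oriented_phi b (G (glue (S k) y1 (const_seq b)))).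
    { apply lex_lt_oriented_phi, Hm.
      - apply Hck. intros i Hi. unfold y0, glue. destruct (Nat.ltb_spec i (S k)); [|lia].
        destruct (Nat.ltb_spec i k); [reflexivity|lia].
      - apply Hck. intros i Hi. unfold y1, glue. destruct (Nat.ltb_spec i (S k)); [|lia].
        destruct (Nat.ltb_spec i k); [reflexivity|lia].
      - exists k. unfold y0, y1. split; [|split].
        + intros i Hi. unfold glue. destruct (Nat.ltb_spec i (S k)); [|lia].
          destruct (Nat.ltb_spec i k); [reflexivity|lia].
        + unfold glue, const_seq. destruct (Nat.ltb_spec k (S k)); [|lia]. destruct (Nat.ltb_spec k k); [lia|reflexivity].
        + unfold glue, const_seq. destruct (Nat.ltb_spec k (S k)); [|lia]. destruct (Nat.ltb_spec k k); [lia|reflexivity]. }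
    (* Since [G] is increasing, the images of the two halves do not overlap, so at least one half
       inherits the invariant. *)
    assert (Hsum : len (S k) y0 + len (S k) y1 <= len k y).
    { unfold len. rewrite E0, E1. fold y0 y1. lra. }
    replace (S k + L + 1)%nat with (S (k + L + 1)) by lia. rewrite pow2_succ_inv.
    assert (A0 : agree p c0 y0) by (apply Hck, agree_glue).
    assert (A1 : agree p c0 y1) by (apply Hck, agree_glue).
    destruct (Rle_dec (len (S k) y0) (/ 2 ^ (k + L + 1) / 2)).
    + exists y0; repeat split; auto; [apply agree_glue].
    + exists y1; repeat split; auto; [apply agree_glue|lra].
  (* At the limit point a deep cone is mapped affinely, so the length of its image is known exactly
     and contradicts the invariant. *)
  - destruct (Hz p (Nat.le_refl p)) as (_ & Hzp & _).
    destruct (HL z Hzp) as (d & (N & M & HPR & Hd) & Hd').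
    apply (prefix_map_raise _ _ _ _ p) in HPR.
    destruct (Hz (N + p)%nat ltac:(lia)) as (_ & _ & Hlen). unfold len in Hlen.
    rewrite !HPR, oriented_phi_glue_length in Hlen.
    assert (/ 2 ^ (N + p + L) <= / 2 ^ (M + p)).
    { apply Rinv_le_contravar; [apply pow2_pos|]. apply Rle_pow; [lra|lia]. }
    replace (N + p + L + 1)%nat with (S (N + p + L)) in Hlen by lia. rewrite pow2_succ_inv in Hlen.
    assert (0 < / 2 ^ (N + p + L)) by (apply Rinv_0_lt_compat, pow2_pos). lra.
Qed.

Lemma lex_lt_of_prefix b j s u : agree (S j) (const_seq b) s -> agree j (const_seq b) u -> u j = negb b -> lex_lt b s u.
Proof.
  intros H1 H2 H3. exists j; split; [|split; [rewrite <- H1 by lia; reflexivity|exact H3]].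
  apply agree_trans with (const_seq b); [apply agree_sym; eapply agree_le; [|exact H1]; lia|exact H2].
Qed.

(** Once the first [k] digits have stabilised, the next digit can change only from [negb b] to [b],
    hence at most once. *)
Lemma decreasing_limit b (t : nat -> Cantor) :
  (forall n, lex_lt b (t (S n)) (t n)) ->
  exists z, forall k, exists n0, forall n, (n0 <= n)%nat -> agree k z (t n).
Proof.
  intros Hdec.
  destruct (bisection (fun k z => exists n0, forall n, (n0 <= n)%nat -> agree k z (t n)) 0 (const_seq b)) as [z [_ Hz]].
  - intros k x y Hxy [n0 H]. exists n0; intros n Hn. apply agree_trans with x; [apply agree_sym|]; auto.
  - exists O; intros n _ i Hi; lia.
  - intros k z _ [n0 H].
    assert (Hext : forall c n, (n0 <= n)%nat -> t n k = c -> agree (S k) (glue k z (const_seq c)) (t n)).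
    { intros c n Hn Hc i Hi. unfold glue, const_seq. destruct (Nat.ltb_spec i k); [apply H; assumption|].
      replace i with k by lia; auto. }
    destruct (classic (exists n1, (n0 <= n1)%nat /\ t n1 k = b)) as [(n1 & Hn1 & Hb)|Hno].
    + exists (glue k z (const_seq b)); split; [apply agree_glue|]. exists n1; intros n Hn. apply Hext; [lia|].
      induction Hn as [|n Hn IH]; [exact Hb|].
      destruct (Hdec n) as (m & D1 & D2 & D3).
      destruct (lt_eq_lt_dec m k) as [[Hm|Hm]|Hm].
      * exfalso. pose proof (H n ltac:(lia) m Hm) as K1. pose proof (H (S n) ltac:(lia) m Hm) as K2.
        rewrite D3 in K1; rewrite D2 in K2. destruct b; simpl in K1; congruence.
      * subst m. rewrite IH in D3. destruct b; discriminate.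
      * rewrite D1 by exact Hm; exact IH.
    + exists (glue k z (const_seq (negb b))); split; [apply agree_glue|]. exists n0; intros n Hn.
      apply Hext; [exact Hn|]. destruct (t n k) eqn:Ht, b; try reflexivity; exfalso; apply Hno; exists n; auto.
  - exists z; intro k; apply Hz; lia.
Qed.

(* A chart [t |-> glue N x t] in which [g] reads [H], defined near the minimum [const_seq b]. *)
Definition chart (g : Cantor -> Cantor) (x : Cantor) (b : bool) (N K : nat) (H : Cantor -> Cantor) : Prop :=
  x = glue N x (const_seq b) /\
  (forall t, agree K (const_seq b) t -> g (glue N x t) = glue N x (H t)) /\
  (forall t, agree K (const_seq b) t -> H (push b t) = push b (H t)) /\
  (forall s t, agree K (const_seq b) s -> agree K (const_seq b) t -> lex_lt b s t -> lex_lt b (H s) (H t)).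

(** The source and image prefixes of the fixed point may differ in length. The shorter one is used
    on both sides, and the surplus digits [b] are absorbed into [H], either inserted after [h] or
    dropped before it. *)
Lemma regular_fixed_chart g x : g x = x -> regular g x -> exists b N K H, chart g x b N K H.
Proof.
  intros Hx (b & N & M & h & HR). pose proof (regular_data_image _ _ _ _ _ _ HR) as Hi.
  destruct HR as (H1 & H2 & H3 & H4). rewrite Hx in Hi, H2.
  destruct (le_lt_dec N M) as [Hle|Hlt].
  - set (p := (M - N)%nat). assert (HM : M = (N + p)%nat) by (unfold p; lia).
    exists b, N, O, (fun t => glue p (const_seq b) (h t)). repeat split.
    + exact H1.
    + intros t _. rewrite H2, HM. apply glue_tail_const_seq; exact H1.
    + intros t _. rewrite H3, push_glue_const_seq; reflexivity.
    + intros s t _ _ Hst. apply lex_lt_glue; auto.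
  - set (p := (N - M)%nat). assert (HN : N = (M + p)%nat) by (unfold p; lia).
    exists b, M, p, (fun t => h (drop p t)). repeat split.
    + exact Hi.
    + intros t Ht. rewrite <- H2, HN, (glue_tail_const_seq M p x b) by exact Hi.
      rewrite <- (agree_glue_eq _ _ _ Ht); reflexivity.
    + intros t Ht. rewrite (agree_glue_eq _ _ _ Ht), push_glue_const_seq, !drop_glue; apply H3.
    + intros s t Hs Ht Hst. apply H4. apply (lex_lt_glue_inv b p (const_seq b)).
      rewrite <- (agree_glue_eq _ _ _ Hs), <- (agree_glue_eq _ _ _ Ht); exact Hst.
Qed.

Lemma agree_const_seq_glue K n b t : agree K (const_seq b) t -> agree (n + K) (const_seq b) (glue n (const_seq b) t).
Proof.
  intros H i Hi. unfold glue. destruct (Nat.ltb_spec i n); [reflexivity|]. apply (H (i - n)%nat); lia.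
Qed.

Lemma glue_const_seq_S n b t : glue (S n) (const_seq b) t = push b (glue n (const_seq b) t).
Proof. rewrite push_glue_const_seq, glue_const_seq_push. f_equal; lia. Qed.

(** For a point with exactly [j] leading digits [b], this provides a cone that lies below the point
    and omits the minimum. *)
Lemma const_seq_decompose_lt b j s c u :
  lex_lt b (glue (S j) (const_seq b) c) (glue j (const_seq b) (push (negb b) s)) /\
  (c = push (negb b) u -> glue (S j) (const_seq b) c <> const_seq b).
Proof.
  split.
  - apply (lex_lt_of_prefix b j); [apply agree_glue|apply agree_glue|].
    unfold glue. rewrite Nat.ltb_irrefl, Nat.sub_diag; reflexivity.
  - intros -> E. apply (f_equal (fun w => w (S j))) in E. unfold glue, const_seq in E.
    rewrite Nat.ltb_irrefl, Nat.sub_diag in E. simpl in E. destruct b; discriminate.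
Qed.

(** * Orbits decreasing towards a fixed point *)

Section DecreasingOrbit.

Variables (g gi : Cantor -> Cantor) (x : Cantor) (b : bool) (N K : nat) (H : Cantor -> Cantor).
Hypothesis Hp : inv_pair g gi.
Hypothesis HG : tame g.
Hypothesis Hch : chart g x b N K H.
Hypothesis Hiso : forall t, agree K (const_seq b) t -> t <> const_seq b -> locally_linear g (glue N x t).

Variable t0 : Cantor.
Hypothesis Ht0 : agree K (const_seq b) t0.
Hypothesis Ht1 : agree K (const_seq b) (H t0).
Hypothesis Hdec0 : lex_lt b (H t0) t0.

Let t (n : nat) : Cantor := Nat.iter n H t0.

Lemma orbit_decreasing n : agree K (const_seq b) (t n) /\ agree K (const_seq b) (t (S n)) /\ lex_lt b (t (S n)) (t n).
Proof.
  destruct Hch as (_ & _ & _ & Hm). induction n as [|n (I1 & I2 & I3)].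
  - repeat split; assumption.
  - assert (L : lex_lt b (t (S (S n))) (t (S n))) by (apply Hm; assumption).
    split; [exact I2|]. split; [|exact L]. eapply lex_lt_near_min; eauto.
Qed.

(** Points below [t0] are kept under its orbit by monotonicity, so they never leave the chart and
    [g] can be iterated there as [H]. *)
Lemma below_orbit w n : lex_lt b w t0 ->
  lex_lt b (Nat.iter n H w) (t n) /\ agree K (const_seq b) (Nat.iter n H w) /\
  Nat.iter n g (glue N x w) = glue N x (Nat.iter n H w).
Proof.
  intros Hw. destruct Hch as (_ & Hg & _ & Hm). induction n as [|n (I1 & I2 & I3)].
  - split; [exact Hw|]. split; [|reflexivity]. eapply lex_lt_near_min; eauto.
  - assert (L : lex_lt b (Nat.iter (S n) H w) (t (S n))).
    { apply Hm; [exact I2|apply orbit_decreasing|exact I1]. }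
    split; [exact L|]. split.
    + eapply lex_lt_near_min; [exact L|]. apply orbit_decreasing.
    + simpl. rewrite I3. apply Hg; exact I2.
Qed.

Lemma below_orbit_mono w w' n : lex_lt b w w' -> lex_lt b w' t0 ->
  lex_lt b (Nat.iter n H w) (Nat.iter n H w').
Proof.
  intros Hw Hw'. destruct Hch as (_ & _ & _ & Hm). induction n; [exact Hw|].
  apply Hm; [| |exact IHn]; apply below_orbit; [eapply lex_lt_trans; eauto|exact Hw'].
Qed.

Lemma iter_glue_const_seq n i : Nat.iter i H (glue n (const_seq b) t0) = glue n (const_seq b) (t i).
Proof.
  destruct Hch as (_ & _ & He & _).
  assert (A : forall s, agree K (const_seq b) s -> H (glue n (const_seq b) s) = glue n (const_seq b) (H s)).
  { intros s Hs. induction n as [|n' IH].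
    - replace (glue 0 (const_seq b) s) with s by seqext. seqext.
    - rewrite !glue_const_seq_S, <- IH. apply He. eapply agree_le; [|apply agree_const_seq_glue; exact Hs]; lia. }
  induction i; [reflexivity|]. simpl. rewrite IHi. apply A, orbit_decreasing.
Qed.

(** If [k] steps bring [t0] below its copy at the next smaller scale, then by equivariance every
    further [k] steps gain one more scale. *)
Lemma orbit_exponential k n : lex_lt b (t k) (push b t0) ->
  t (n * k) = glue n (const_seq b) t0 \/ lex_lt b (t (n * k)) (glue n (const_seq b) t0).
Proof.
  intros Hk. destruct Hch as (_ & _ & _ & Hm). induction n as [|n IH].
  - left. unfold t; simpl. seqext.
  - right. assert (E : t (S n * k) = Nat.iter k H (t (n * k))).
    { unfold t. simpl Nat.mul. apply Nat.iter_add. }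
    rewrite E. assert (L : lex_lt b (glue n (const_seq b) (t k)) (glue (S n) (const_seq b) t0)).
    { rewrite glue_const_seq_S, push_glue_const_seq. apply lex_lt_glue; exact Hk. }
    destruct IH as [->|IH].
    + rewrite iter_glue_const_seq; exact L.
    + eapply lex_lt_trans; [|exact L]. rewrite <- iter_glue_const_seq. clear E L Hk.
      assert (Hi : forall i, lex_lt b (Nat.iter i H (t (n * k))) (Nat.iter i H (glue n (const_seq b) t0))); [|apply Hi].
      intro i; induction i as [|i IHi]; [exact IH|]. refine (Hm _ _ _ _ IHi).
      * replace (Nat.iter i H (t (n * k))) with (t (i + n * k)) by apply Nat.iter_add. apply orbit_decreasing.
      * rewrite iter_glue_const_seq. eapply agree_le; [|apply agree_const_seq_glue; apply orbit_decreasing]; lia.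
Qed.

Lemma fixes_base : g x = x.
Proof.
  destruct Hch as (Hx & Hg & He & _).
  assert (E : H (const_seq b) = const_seq b).
  { assert (Q : H (const_seq b) = push b (H (const_seq b))).
    { rewrite <- He by apply agree_refl. f_equal. apply functional_extensionality; intros [|i]; reflexivity. }
    apply functional_extensionality; intro i; induction i; rewrite Q; simpl; [reflexivity|exact IHi]. }
  rewrite Hx at 1. rewrite Hg by apply agree_refl. rewrite E; symmetry; exact Hx.
Qed.

(* The orbit converges to a fixed point: either a hyperbolic locally linear one, or the singularity itself, which by equivariance then attracts exponentially fast. *)
Lemma decreasing_orbit_linear_growth : linear_growth g.
Proof.
  destruct (decreasing_limit b t) as [z Hz]; [intro n; apply orbit_decreasing|].
  destruct Hch as (Hx & Hg & He & Hm).
  assert (HzK : agree K (const_seq b) z).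
  { destruct (Hz K) as [n0 Hn]. specialize (Hn n0 (Nat.le_refl n0)).
    apply agree_trans with (t n0); [apply orbit_decreasing|apply agree_sym; exact Hn]. }
  destruct (tame_bounded_by g HG) as (A0 & L0 & HB).
  destruct (classic (z = const_seq b)) as [Ez|Ez].
  - subst z.
    assert (Hfix : forall i, Nat.iter i g x = x).
    { intro i; induction i as [|i IH]; [reflexivity|]. simpl. rewrite IH; apply fixes_base. }
    assert (Hne : push b t0 <> const_seq b).
    { intro E. rewrite (push_head (const_seq b)) in E. apply push_inj in E.
      apply (lex_lt_irrefl b (t 1)). eapply lex_lt_trans; [exact Hdec0|]. rewrite E.
      apply lex_lt_min. intro E'. unfold t in E'; simpl in E'. rewrite E', E in Hdec0.
      exact (lex_lt_irrefl _ _ Hdec0). }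
    (* [j] is the first position where [push b t0] leaves [b]; an orbit point with more than [j]
       leading digits [b] therefore lies below it. *)
    destruct (lex_lt_min b _ Hne) as (j & J1 & _ & J3).
    destruct (Hz (S j)) as [k Hk].
    assert (Hk' : lex_lt b (t (S k)) (push b t0)).
    { apply (lex_lt_of_prefix b j); [apply Hk; lia|exact J1|exact J3]. }
    apply (linear_growth_iter g gi A0 L0 (S k)); [exact Hp|exact HB|lia|].
    destruct (glue_const_seq_decompose b t0) as (j0 & s0 & Hs0).
    { intro E. apply Hne. rewrite E. apply functional_extensionality; intros [|i]; reflexivity. }
    (* The slope estimate below compares a cone of depth [N + j0 + 2] with an image in a cone of
       depth [N + n], which gives [n <= j0 + 2 + L]. *)
    exists (j0 + 2)%nat. intros n A L HBn.
    set (G := Nat.iter n (Nat.iter (S k) g)) in *.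
    assert (EG : forall y, G y = Nat.iter (n * S k) g y) by (intro y; apply iter_mul).
    (* The cone at [c0] with one more [b] than [t0] and then [negb b] lies below [t0] and avoids the
       singularity, so every iterate is linear at each of its points. *)
    set (c0 := glue N x (glue (S j0) (const_seq b) (const_seq (negb b)))).
    assert (Hcone : forall y, agree (N + (S j0 + 1)) c0 y ->
              exists w, y = glue N x w /\ lex_lt b w t0 /\ w <> const_seq b).
    { intros y Hy. set (s := drop (N + (S j0 + 1)) y).
      exists (glue (S j0) (const_seq b) (push (negb b) s)). split; [|split].
      - rewrite (agree_glue_eq _ _ _ Hy) at 1. unfold c0. rewrite glue_glue, glue_glue. f_equal. f_equal.
        fold s. rewrite push_glue; reflexivity.
      - rewrite Hs0. apply (const_seq_decompose_lt b j0 s0 _ s).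
      - apply (const_seq_decompose_lt b j0 s0 _ s); reflexivity. }
    assert (Himg : forall w, lex_lt b w t0 -> agree (N + n) x (G (glue N x w))).
    { intros w Hw. rewrite EG. destruct (below_orbit w (n * S k) Hw) as (B1 & B2 & B3). rewrite B3.
      rewrite Hx at 1. apply agree_glue_glue. eapply lex_lt_near_min; [exact B1|].
      destruct (orbit_exponential (S k) n Hk') as [->|B]; [apply agree_glue|].
      eapply lex_lt_near_min; [exact B|apply agree_glue]. }
    assert (Hle : (N + n <= N + (S j0 + 1) + L)%nat); [|nia].
    apply (slope_of_contraction b G c0).
    + intros y Hy. destruct (Hcone y Hy) as (w & -> & Hw & Hwn).
      assert (HLL : forall i, locally_linear (Nat.iter i g) (glue N x w)).
      { intro i; induction i; [apply locally_linear_id|]. apply (locally_linear_comp (Nat.iter i g) g); [exact IHi|].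
        destruct (below_orbit w i Hw) as (B1 & B2 & B3). rewrite B3. apply Hiso; [exact B2|].
        intro E. rewrite E, <- Hx in B3.
        rewrite <- (Hfix i) in B3 at 2. apply (inv_pair_inj _ (Nat.iter i gi)) in B3; [|apply inv_pair_iter; exact Hp].
        apply Hwn. rewrite Hx in B3 at 2. apply glue_inj in B3; exact B3. }
      destruct (HLL (n * S k)%nat) as [d Hd]. exists d.
      assert (Hd' : log_contraction G (glue N x w) d).
      { apply (log_contraction_ext (Nat.iter (n * S k) g) G _ d 0); [|exact Hd]. intros; symmetry; apply EG. }
      split; [exact Hd'|]. eapply bounded_by_slope; eauto.
    + intros y y' Hy Hy' Hyy. destruct (Hcone y Hy) as (w & -> & Hw & _).
      destruct (Hcone y' Hy') as (w' & -> & Hw' & _).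
      apply lex_lt_glue_inv in Hyy. rewrite !EG.
      destruct (below_orbit w (n * S k) Hw) as (_ & _ & ->).
      destruct (below_orbit w' (n * S k) Hw') as (_ & _ & ->).
      apply lex_lt_glue, below_orbit_mono; assumption.
    + intros y Hy. destruct (Hcone y Hy) as (w & -> & Hw & _).
      destruct (Hcone c0 (agree_refl _ _)) as (w' & Ew' & Hw' & _). rewrite Ew'.
      apply agree_trans with x; [apply agree_sym|]; apply Himg; assumption.
  (* The limit is fixed by continuity and [g] is linear there. Slope 1 would make [g] the identity
     nearby, against the strict descent of the orbit. *)
  - pose proof (Hiso z HzK Ez) as HLL.
    assert (Hfix : g (glue N x z) = glue N x z).
    { apply agree_all; intro k. destruct (locally_linear_cantor_continuous _ _ HLL k) as [q Hq].
      destruct (Hz (q + k)%nat) as [n0 Hn].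
      assert (E : g (glue N x (t n0)) = glue N x (t (S n0))) by (apply Hg, orbit_decreasing).
      apply agree_trans with (glue N x (t (S n0))).
      - rewrite <- E. apply Hq. apply (agree_le _ (N + (q + k))); [lia|].
        apply agree_glue_glue, Hn; lia.
      - apply agree_sym. apply (agree_le _ (N + (q + k))); [lia|].
        apply agree_glue_glue, Hn; lia. }
    destruct (locally_linear_fixed g _ Hfix HLL) as [|[q Hq]]; [assumption|exfalso].
    destruct (Hz q) as [n0 Hn].
    assert (E : g (glue N x (t n0)) = glue N x (t n0)).
    { apply Hq. apply (agree_le _ (N + q)); [lia|]. apply agree_glue_glue, Hn; lia. }
    rewrite Hg in E by apply orbit_decreasing. apply glue_inj in E.
    destruct (orbit_decreasing n0) as (_ & _ & Hlt).
    change (t (S n0)) with (H (t n0)) in Hlt. rewrite E in Hlt. exact (lex_lt_irrefl _ _ Hlt).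
Qed.

End DecreasingOrbit.

(** * The dichotomy at a fixed point *)

Lemma chart_raise g x b N K K' H : (K <= K')%nat -> chart g x b N K H -> chart g x b N K' H.
Proof.
  intros HK (H1 & H2 & H3 & H4). repeat split; [exact H1| | |]; intros.
  - apply H2; eapply agree_le; eauto.
  - apply H3; eapply agree_le; eauto.
  - apply H4; try assumption; eapply agree_le; eauto.
Qed.

Lemma isolated_chart g x : tame g -> g x = x -> regular g x ->
  exists b N K H, chart g x b N K H /\
    forall t, agree K (const_seq b) t -> t <> const_seq b -> locally_linear g (glue N x t).
Proof.
  intros (_ & [E HE] & _) Hx HR. destruct (regular_fixed_chart g x Hx HR) as (b & N & K & H & HC).
  destruct (cone_isolates E x) as [K1 HK1].
  exists b, N, (K + K1)%nat, H. split; [apply (chart_raise _ _ _ _ K); [lia|exact HC]|].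
  intros t Ht Hne. apply HE; intro Hin. destruct HC as (Hxc & _). apply HK1 in Hin.
  - rewrite Hxc in Hin at 2. apply glue_inj in Hin. auto.
  - rewrite Hxc at 1. apply (agree_le _ (N + (K + K1))); [lia|]. apply agree_glue_glue; exact Ht.
Qed.

(** A single nearby point that moves towards [x] suffices, since monotonicity propagates the descent
    along its whole orbit. *)
Lemma regular_fixed_decreasing g gi x : inv_pair g gi -> tame g -> g x = x -> regular g x ->
  exists b K, (exists N, x = glue N x (const_seq b)) /\
    forall y, agree K x y -> agree K x (g y) -> lex_lt b (g y) y -> linear_growth g.
Proof.
  intros Hp HG Hx HR. destruct (isolated_chart g x HG Hx HR) as (b & N & K & H & HC & Hiso).
  exists b, (N + K)%nat. split; [exists N; apply HC|]. intros y Hy Hgy Hlt.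
  pose proof HC as (H1 & H2 & _ & _).
  assert (Hsh : forall w, agree (N + K) x w -> exists s, w = glue N x s /\ agree K (const_seq b) s).
  { intros w Hw. exists (drop N w). split; [apply agree_glue_eq; eapply agree_le; [|exact Hw]; lia|].
    rewrite <- (drop_glue N x (const_seq b)), <- H1. apply agree_drop; exact Hw. }
  destruct (Hsh y Hy) as (t0 & -> & Ht0). destruct (Hsh _ Hgy) as (t1 & E1 & Ht1).
  pose proof (H2 t0 Ht0) as E2. rewrite E2 in E1. apply glue_inj in E1. subst t1.
  rewrite E2 in Hlt. apply lex_lt_glue_inv in Hlt.
  apply (decreasing_orbit_linear_growth g gi x b N K H) with (t0 := t0); auto.
Qed.

(** At a regular germ, a nearby point that is not fixed either moves towards [x] under [g], or its
    image does so under [gi]; linear growth passes between a map and its inverse. *)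
Lemma fixed_point_dichotomy g gi x : inv_pair g gi -> tame g -> g x = x ->
  linear_growth g \/ exists N, forall y, agree N x y -> g y = y.
Proof.
  intros Hp HG Hx. pose proof HG as (_ & _ & Hgerm). destruct (Hgerm x) as [HL|HR].
  { apply locally_linear_fixed; assumption. }
  pose proof (tame_inv _ _ Hp HG) as HGi. pose proof (tame_cantor_continuous _ HG) as Hc. pose proof (tame_cantor_continuous _ HGi) as Hci.
  assert (Hxi : gi x = x) by (rewrite <- Hx at 1; apply Hp).
  assert (HRi : regular gi x) by (rewrite <- Hx; apply regular_inv; assumption).
  destruct (regular_fixed_decreasing g gi x Hp HG Hx HR) as (b & K & [N1 Hb] & Hd).
  destruct (regular_fixed_decreasing gi g x (inv_pair_sym _ _ Hp) HGi Hxi HRi) as (b' & K' & [N2 Hb'] & Hd').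
  assert (b' = b) as -> by (eapply tail_const_seq_unique; eauto).
  destruct (Hc x (K + K')%nat) as [N HN]. rewrite Hx in HN.
  destruct (classic (linear_growth g)) as [|HnLG]; [left; assumption|right].
  exists (N + K + K')%nat. intros y Hy. apply NNPP; intro Hne. apply HnLG.
  assert (Hy1 : agree (K + K') x y) by (eapply agree_le; [|exact Hy]; lia).
  assert (Hy2 : agree (K + K') x (g y)) by (apply HN; eapply agree_le; [|exact Hy]; lia).
  destruct (lex_lt_total b _ _ Hne) as [L|L].
  - apply (Hd y); [| |exact L]; (eapply agree_le; [|eassumption]; lia).
  - apply (linear_growth_inv g gi Hp). apply (Hd' (g y)).
    + eapply agree_le; [|eassumption]; lia.
    + rewrite (proj1 Hp). eapply agree_le; [|eassumption]; lia.
    + rewrite (proj1 Hp). exact L.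
Qed.

(** * Infinite order forces linear growth *)

Lemma pigeonhole (s : nat -> nat) K :
  (forall i, (i <= K)%nat -> (s i < K)%nat) -> exists i j, (i < j <= K)%nat /\ s i = s j.
Proof.
  intros H. apply NNPP; intro Hno.
  assert (Hnd : NoDup (map s (seq 0 (S K)))).
  { apply NoDup_map_NoDup_ForallPairs; [|apply seq_NoDup].
    intros i j Hi Hj E. apply in_seq in Hi; apply in_seq in Hj.
    destruct (lt_eq_lt_dec i j) as [[L|L]|L]; [exfalso|exact L|exfalso].
    - apply Hno; exists i, j; split; [lia|exact E].
    - apply Hno; exists j, i; split; [lia|auto]. }
  pose proof (NoDup_incl_length Hnd (l' := seq 0 K)) as Hl.
  rewrite length_map, !length_seq in Hl. specialize (Hl ltac:(
    intros v Hv; apply in_map_iff in Hv; destruct Hv as (i & <- & Hi); apply in_seq in Hi;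
    apply in_seq; specialize (H i); lia)). lia.
Qed.

(** The net change of prefix length along a path whose [k]-th step replaces a prefix of length [D]
    by one of length [M k]. *)
Fixpoint depth_change (M : nat -> nat) (D : nat) (n : nat) : Z :=
  match n with O => 0%Z | S k => (depth_change M D k + (Z.of_nat (M k) - Z.of_nat D))%Z end.

Fixpoint time_sum (tau : nat -> nat) (n : nat) : nat :=
  match n with O => O | S k => (tau k + time_sum tau k)%nat end.

Definition path_step (F : Cantor -> Cantor) (xs : nat -> Cantor) (tau M : nat -> nat) (D l : nat) : Prop :=
  (1 <= tau l)%nat /\ xs (S l) = Nat.iter (tau l) F (xs l) /\ prefix_map (Nat.iter (tau l) F) (xs l) D (M l).

(* As long as the depth stays at least [D], the next step is defined on the whole current image cone. *)
Lemma path_prefix_map F xs tau M D L n :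
  (forall l, (l < n)%nat -> path_step F xs tau M D l) ->
  (forall l, (l <= n)%nat -> (Z.of_nat D <= Z.of_nat L + depth_change M D l)%Z) ->
  Nat.iter (time_sum tau n) F (xs O) = xs n /\
  prefix_map (Nat.iter (time_sum tau n) F) (xs O) L (Z.to_nat (Z.of_nat L + depth_change M D n)) /\ (n <= time_sum tau n)%nat.
Proof.
  intros Hs Hc. induction n as [|n IH].
  - simpl. split; [reflexivity|]. split; [|lia].
    replace (Z.to_nat (Z.of_nat L + 0)) with L by lia. intro t; reflexivity.
  - destruct IH as (I1 & I2 & I3); [intros; apply Hs; lia|intros; apply Hc; lia|].
    destruct (Hs n) as (S1 & S2 & S3); [lia|]. pose proof (Hc n ltac:(lia)) as Cn.
    assert (E : Nat.iter (time_sum tau (S n)) F = fun y => Nat.iter (tau n) F (Nat.iter (time_sum tau n) F y)).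
    { apply functional_extensionality; intro y. simpl time_sum. apply Nat.iter_add. }
    rewrite E. split; [rewrite I1; auto|]. split; [|simpl; lia].
    apply prefix_map_comp with (Z.to_nat (Z.of_nat L + depth_change M D n)); [exact I2|]. rewrite I1.
    apply (prefix_map_raise _ _ _ _ (Z.to_nat (Z.of_nat L + depth_change M D n) - D)) in S3.
    simpl depth_change. replace (Z.to_nat (Z.of_nat L + depth_change M D n)) with (D + (Z.to_nat (Z.of_nat L + depth_change M D n) - D))%nat at 1 by lia.
    replace (Z.to_nat (Z.of_nat L + (depth_change M D n + (Z.of_nat (M n) - Z.of_nat D))))
      with (M n + (Z.to_nat (Z.of_nat L + depth_change M D n) - D))%nat by lia. exact S3.
Qed.

Lemma depth_change_from M D i n : depth_change (fun l => M (i + l)%nat) D n = (depth_change M D (i + n) - depth_change M D i)%Z.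
Proof.
  induction n; [rewrite Nat.add_0_r; simpl; lia|]. rewrite Nat.add_succ_r. simpl. rewrite IHn; lia.
Qed.

Lemma last_below (c : nat -> Z) r n : (c O <= r)%Z ->
  exists i, (i <= n)%nat /\ (c i <= r)%Z /\ forall k, (i < k <= n)%nat -> (r < c k)%Z.
Proof.
  intros H0. induction n as [|n (i & I1 & I2 & I3)].
  - exists O; repeat split; [lia|exact H0|intros; lia].
  - destruct (Z_le_gt_dec (c (S n)) r) as [L|L].
    + exists (S n); repeat split; [lia|exact L|intros; lia].
    + exists i; repeat split; [lia|exact I2|]. intros k Hk.
      destruct (Nat.eq_dec k (S n)) as [->|]; [lia|apply I3; lia].
Qed.

(* Cut a strongly contracting path at the last times its depth is below the levels [0, b, 2b, ...]; two of these cuts lie in the same cone of depth [D]. *)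
Lemma path_contraction F xs tau M D B n :
  (forall l, (l < n)%nat -> path_step F xs tau M D l /\ (M l <= D + B)%nat) ->
  (Z.of_nat ((B + 1) * (2 ^ D + 1)) < depth_change M D n)%Z ->
  exists z T d, (1 <= T)%nat /\ (1 <= d)%nat /\ prefix_map (Nat.iter T F) z D (D + d) /\ agree D z (Nat.iter T F z).
Proof.
  intros Hs Hn. set (c := depth_change M D) in *.
  (* The levels are spaced by [B + 1], more than a single step can rise, so a cut at a higher level
     has strictly larger depth. The threshold in the hypothesis exceeds the highest of the
     [2 ^ D + 1] levels. *)
  assert (Hch : forall j : nat, exists i, (i <= n)%nat /\ (c i <= Z.of_nat (j * (B + 1)))%Z /\
            forall k, (i < k <= n)%nat -> (Z.of_nat (j * (B + 1)) < c k)%Z).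
  { intro j; apply last_below. unfold c; simpl; lia. }
  pose (i_ := fun j => proj1_sig (constructive_indefinite_description _ (Hch j))).
  assert (Hi : forall j, (i_ j <= n)%nat /\ (c (i_ j) <= Z.of_nat (j * (B + 1)))%Z /\
            forall k, (i_ j < k <= n)%nat -> (Z.of_nat (j * (B + 1)) < c k)%Z).
  { intro j; unfold i_; destruct (constructive_indefinite_description _ _); assumption. }
  clearbody i_. clear Hch.
  destruct (pigeonhole (fun j => valN D (xs (i_ j))) (2 ^ D)) as (j & j' & Hj & Hv).
  { intros; apply valN_lt. }
  apply valN_agree_inv in Hv.
  destruct (Hi j) as (A1 & A2 & A3), (Hi j') as (B1 & B2 & B3).
  set (i := i_ j) in *. set (i' := i_ j') in *.
  assert (Hgap : (j * (B + 1) + (B + 1) <= j' * (B + 1))%nat) by nia.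
  assert (Hbound : (j' * (B + 1) < (B + 1) * (2 ^ D + 1))%nat) by nia.
  assert (Hi'n : (i' < n)%nat).
  { destruct (Nat.eq_dec i' n) as [E|]; [rewrite E in B2; lia|lia]. }
  assert (Hci' : (Z.of_nat (j' * (B + 1)) - Z.of_nat B < c i')%Z).
  { pose proof (B3 (S i') ltac:(lia)) as Q. unfold c in Q; simpl in Q; fold c in Q.
    destruct (Hs i' Hi'n) as [_ HM]. lia. }
  assert (Hii' : (i < i')%nat).
  { destruct (lt_eq_lt_dec i i') as [[L|L]|L]; [exact L|rewrite L in A2; lia|].
    pose proof (B3 i ltac:(lia)); lia. }
  set (k := (i' - i)%nat).
  destruct (path_prefix_map F (fun l => xs (i + l)%nat) (fun l => tau (i + l)%nat) (fun l => M (i + l)%nat) D D k)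
    as (P1 & P2 & P3).
  { intros l Hl. destruct (Hs (i + l)%nat) as [H _]; [unfold k in Hl; lia|].
    unfold path_step in *. rewrite Nat.add_succ_r. exact H. }
  (* After its last time at or below a level the path stays above it, so the cone of depth [D]
     chosen at time [i] never becomes too shallow for the next step. *)
  { intros l Hl. rewrite depth_change_from. fold c. destruct l as [|l]; [rewrite Nat.add_0_r; lia|].
    pose proof (A3 (i + S l)%nat ltac:(unfold k in Hl; lia)). lia. }
  rewrite depth_change_from in P2. fold c in P2. rewrite Nat.add_0_r in *.
  replace (i + k)%nat with i' in * by (unfold k; lia).
  exists (xs i), (time_sum (fun l => tau (i + l)%nat) k), (Z.to_nat (c i' - c i)).
  split; [unfold k in *; lia|]. split; [lia|]. split.
  - replace (D + Z.to_nat (c i' - c i))%nat with (Z.to_nat (Z.of_nat D + (c i' - c i))) by lia. exact P2.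
  - rewrite P1; exact Hv.
Qed.

(** Reversed, a step replaces a prefix of length [M] by one of length [D]. Raising both by
    [D + B - M] makes all reversed steps consume the same depth [D + B], as [path_step] requires. *)
Lemma depth_change_reverse M D B n l : (l <= n)%nat -> (forall i, (i < n)%nat -> (M i <= D + B)%nat) ->
  depth_change (fun l => (D + (D + B - M (n - 1 - l)))%nat) (D + B) l = (depth_change M D (n - l) - depth_change M D n)%Z.
Proof.
  intros Hl HM. induction l.
  - rewrite Nat.sub_0_r; simpl; lia.
  - simpl depth_change at 1. rewrite IHl by lia.
    replace (n - l)%nat with (S (n - 1 - l)) by lia. replace (n - S l)%nat with (n - 1 - l)%nat by lia.
    simpl depth_change. pose proof (HM (n - 1 - l)%nat ltac:(lia)). lia.
Qed.

Lemma divide_fact r n : (1 <= r <= n)%nat -> exists q, fact n = (q * r)%nat.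
Proof.
  intros H. induction n; [lia|]. destruct (Nat.eq_dec r (S n)) as [->|].
  - exists (fact n). simpl; lia.
  - destruct IHn as [q Hq]; [lia|]. exists (S n * q)%nat. change (fact (S n)) with (S n * fact n)%nat. rewrite Hq; lia.
Qed.

Lemma iter_periodic f (x : Cantor) r q : Nat.iter r f x = x -> Nat.iter (q * r) f x = x.
Proof.
  intros H. rewrite <- iter_mul. induction q; simpl; [reflexivity|]. rewrite IHq; exact H.
Qed.

Lemma digits_unique k k' v v' q : (v < q)%nat -> (v' < q)%nat -> (k * q + v = k' * q + v')%nat -> k = k' /\ v = v'.
Proof.
  intros H H' E. assert (k = k') by (destruct (lt_eq_lt_dec k k') as [[L|L]|L]; nia). subst; lia.
Qed.

(** * A uniform period from bounded depth *)

Section FiniteOrder.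

Variables (f fi : Cantor -> Cantor) (Y : Cantor -> Prop) (tau : Cantor -> nat) (m D B : nat).
Hypothesis Hp : inv_pair f fi.
Hypothesis HG : tame f.
Hypothesis HnLG : ~ linear_growth f.
Hypothesis Htau : forall x, (1 <= tau x <= m)%nat.
Hypothesis HY : forall x, Y x -> Y (Nat.iter (tau x) f x).
Hypothesis HPR : forall x, Y x -> exists M, (M <= D + B)%nat /\ prefix_map (Nat.iter (tau x) f) x D M.

Lemma no_contraction F Fi z T d D' :
  (F = f \/ F = fi) -> inv_pair F Fi -> (1 <= T)%nat -> (1 <= d)%nat ->
  prefix_map (Nat.iter T F) z D' (D' + d) -> agree D' z (Nat.iter T F z) -> False.
Proof.
  intros HF HFi HT Hd H1 H2. apply HnLG.
  assert (HL : linear_growth F).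
  { assert (HGF : tame F) by (destruct HF as [->| ->]; [exact HG|apply (tame_inv f); assumption]).
    destruct (tame_bounded_by F HGF) as (A0 & L0 & HB). apply (linear_growth_iter F Fi A0 L0 T); auto.
    apply (linear_growth_contract _ z D' d); assumption. }
  destruct HF as [->| ->]; [exact HL|apply (linear_growth_inv f fi); assumption].
Qed.

(** Without contracting cones the depth change along every path is bounded on both sides. Each orbit
    point is then a prefix of bounded length followed by the tail of [x0] after [L] digits, so only
    finitely many points occur. Return times are at most [m * K], and the factorial is a multiple of
    all of them. *)
Lemma uniform_period : exists P, (1 <= P)%nat /\ forall x, Y x -> Nat.iter P f x = x.
Proof.
  assert (Hch : forall x, exists M, Y x -> (M <= D + B)%nat /\ prefix_map (Nat.iter (tau x) f) x D M).
  { intro x. destruct (classic (Y x)) as [H|H]; [destruct (HPR x H) as [M HM]; exists M; auto|exists O; tauto]. }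
  pose (Mf := fun x => proj1_sig (constructive_indefinite_description _ (Hch x))).
  assert (HM : forall x, Y x -> (Mf x <= D + B)%nat /\ prefix_map (Nat.iter (tau x) f) x D (Mf x)).
  { intro x; unfold Mf; destruct (constructive_indefinite_description _ _); assumption. }
  clearbody Mf. clear Hch.
  (* [B1] and [B2] bound the rise and the fall of the depth, the latter by the same estimate for the
     inverse with [D + B] and [D] in place of [D] and [B]. Starting at depth [L] keeps the depth
     between [D] and [Q], and [K] counts the pairs of a depth change and a prefix number. *)
  set (B1 := ((B + 1) * (2 ^ D + 1))%nat). set (B2 := ((D + 1) * (2 ^ (D + B) + 1))%nat).
  set (L := (D + B2)%nat). set (Q := (L + B1)%nat). set (K := ((B1 + B2 + 1) * 2 ^ Q)%nat).
  exists (fact (m * K)). split; [apply lt_O_fact|]. intros x0 Hx0.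
  set (xs := fun n => Nat.iter n (fun x => Nat.iter (tau x) f x) x0).
  assert (HYs : forall n, Y (xs n)) by (intro n; induction n; [exact Hx0|apply HY; exact IHn]).
  set (ts := fun n => tau (xs n)). set (Ms := fun n => Mf (xs n)).
  assert (Hst : forall l, path_step f xs ts Ms D l /\ (Ms l <= D + B)%nat).
  { intro l. destruct (HM (xs l) (HYs l)) as [H1 H2]. split; [|exact H1]. split; [apply Htau|].
    split; [reflexivity|exact H2]. }
  assert (Hup : forall n, (depth_change Ms D n <= Z.of_nat B1)%Z).
  { intro n. apply Z.nlt_ge; intro Hlt.
    destruct (path_contraction f xs ts Ms D B n) as (z & T & d & T1 & d1 & P1 & P2); [auto|exact Hlt|].
    apply (no_contraction f fi z T d D); auto. }
  (* A strong expansion, read backwards, is a strong contraction of the inverse. *)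
  assert (Hlow : forall n, (- Z.of_nat B2 <= depth_change Ms D n)%Z).
  { intro n. apply Z.nlt_ge; intro Hlt.
    destruct (path_contraction fi (fun l => xs (n - l)%nat) (fun l => ts (n - 1 - l)%nat)
                (fun l => (D + (D + B - Ms (n - 1 - l)))%nat) (D + B) D n) as (z & T & d & T1 & d1 & P1 & P2).
    - intros l Hl. split; [|lia]. destruct (Hst (n - 1 - l)%nat) as [(S1 & S2 & S3) S4].
      replace (S (n - 1 - l)) with (n - l)%nat in S2 by lia.
      pose proof (inv_pair_iter f fi (ts (n - 1 - l)%nat) Hp) as Hpi.
      split; [exact S1|]. split.
      + rewrite S2, (proj1 Hpi). f_equal; lia.
      + pose proof (prefix_map_inv _ _ _ _ _ Hpi S3) as R. rewrite <- S2 in R.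
        apply (prefix_map_raise _ _ _ _ (D + B - Ms (n - 1 - l)%nat)) in R.
        replace (Ms (n - 1 - l)%nat + (D + B - Ms (n - 1 - l)%nat))%nat with (D + B)%nat in R by lia. exact R.
    - rewrite depth_change_reverse by (try lia; intros; apply Hst). rewrite Nat.sub_diag. simpl (depth_change Ms D 0). fold B2. lia.
    - apply (no_contraction fi f z T d (D + B)); auto. apply inv_pair_sym; exact Hp. }
  assert (Hpath : forall n, Nat.iter (time_sum ts n) f x0 = xs n /\
            prefix_map (Nat.iter (time_sum ts n) f) x0 L (Z.to_nat (Z.of_nat L + depth_change Ms D n))).
  { intro n. destruct (path_prefix_map f xs ts Ms D L n) as (P1 & P2 & _).
    - intros l _; apply Hst.
    - intros l _. pose proof (Hlow l). unfold L. lia.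
    - auto. }
  set (dep := fun n => Z.to_nat (Z.of_nat L + depth_change Ms D n)) in *.
  assert (Hv : forall n, (valN (dep n) (xs n) < 2 ^ Q)%nat).
  { intro n. apply Nat.lt_le_trans with (2 ^ dep n)%nat; [apply valN_lt|].
    apply Nat.pow_le_mono_r; [lia|]. pose proof (Hup n). unfold dep, Q; lia. }
  destruct (pigeonhole (fun n => (Z.to_nat (depth_change Ms D n + Z.of_nat B2) * 2 ^ Q + valN (dep n) (xs n))%nat) K)
    as (n & n' & Hnn & E).
  { intros n _. pose proof (Hup n). pose proof (Hlow n). pose proof (Hv n).
    assert (Z.to_nat (depth_change Ms D n + Z.of_nat B2) <= B1 + B2)%nat by lia. unfold K. nia. }
  apply digits_unique in E; [|apply Hv|apply Hv]. destruct E as [E1 E2].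
  assert (Ed : dep n = dep n') by (pose proof (Hlow n); pose proof (Hlow n'); unfold dep; lia).
  rewrite <- Ed in E2. apply valN_agree_inv in E2.
  (* Both points carry the same tail [drop L x0] behind prefixes of equal length, so equal prefixes
     make them equal. *)
  assert (Ex : xs n = xs n').
  { destruct (Hpath n) as [Q1 Q2], (Hpath n') as [R1 R2].
    pose proof (Q2 (drop L x0)) as Q3. pose proof (R2 (drop L x0)) as R3.
    rewrite glue_drop in Q3, R3. rewrite Q1 in Q3. rewrite R1 in R3.
    fold (dep n) in Q3. fold (dep n') in R3. rewrite <- Ed in R3.
    rewrite Q3, R3. apply glue_agree; exact E2. }
  assert (Hps : exists r, (1 <= r <= m * K)%nat /\ time_sum ts n' = (time_sum ts n + r)%nat).
  { assert (Hmon : forall k, (k <= time_sum ts (n + k) - time_sum ts n <= m * k)%nat /\ (time_sum ts n <= time_sum ts (n + k))%nat).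
    { intro k; induction k as [|k IHk]; [rewrite Nat.add_0_r; lia|]. rewrite Nat.add_succ_r. simpl time_sum.
      pose proof (Htau (xs (n + k)%nat)). change (tau (xs (n + k)%nat)) with (ts (n + k)%nat) in H. nia. }
    specialize (Hmon (n' - n)%nat). replace (n + (n' - n))%nat with n' in Hmon by lia.
    exists (time_sum ts n' - time_sum ts n)%nat. split; [|lia]. split; [lia|]. nia. }
  destruct Hps as (r & Hr & Er).
  destruct (Hpath n) as [Q1 _], (Hpath n') as [R1 _]. rewrite Er, Nat.iter_add, <- Ex, <- Q1 in R1.
  apply (inv_pair_inj _ (Nat.iter (time_sum ts n) fi)) in R1; [|apply inv_pair_iter; exact Hp].
  destruct (divide_fact r (m * K) Hr) as [q Hq]. rewrite Hq. apply iter_periodic; exact R1.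
Qed.

End FiniteOrder.

(** * Orbits of the singularities *)

Lemma eventually_avoids (s : nat -> Cantor) (E : list Cantor) :
  (forall i j, s i = s j -> i = j) -> exists n0, forall n, (n0 <= n)%nat -> ~ In (s n) E.
Proof.
  intros Hinj. induction E as [|e E [n0 IH]].
  - exists O; intros n _ [].
  - destruct (classic (exists k, s k = e)) as [[k Hk]|Hno].
    + exists (Nat.max n0 (S k)); intros n Hn [Hin|Hin].
      * assert (k = n) by (apply Hinj; congruence). lia.
      * apply (IH n); [lia|exact Hin].
    + exists n0; intros n Hn [Hin|Hin]; [apply Hno; exists n; auto|apply (IH n); assumption].
Qed.

Lemma uniform_over_list {T : Type} (Q : T -> nat -> Prop) (l : list T) :
  (forall a, In a l -> exists N, forall N', (N <= N')%nat -> Q a N') ->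
  exists N, forall N', (N <= N')%nat -> forall a, In a l -> Q a N'.
Proof.
  induction l as [|a l IH]; intro H.
  - exists O; intros N' _ a [].
  - destruct (H a (or_introl eq_refl)) as [N1 H1].
    destruct IH as [N2 H2]; [intros b Hb; apply H; right; exact Hb|].
    exists (Nat.max N1 N2); intros N' HN b [<-|Hb]; [apply H1|apply H2]; auto; lia.
Qed.

Section Singularities.

Variables (f fi : Cantor -> Cantor) (E : list Cantor).
Hypothesis Hp : inv_pair f fi.
Hypothesis HG : tame f.
Hypothesis HE : forall x, ~ In x E -> locally_linear f x.
Hypothesis HnLG : ~ linear_growth f.

Definition periodic x := exists k, (1 <= k)%nat /\ Nat.iter k f x = x.

Definition source p := In p E /\ ~ periodic p /\ forall j, (1 <= j)%nat -> ~ In (Nat.iter j fi p) E.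

Lemma iter_cancel a b x : (a <= b)%nat -> Nat.iter a fi (Nat.iter b f x) = Nat.iter (b - a) f x.
Proof.
  intros H. replace (Nat.iter b f x) with (Nat.iter a f (Nat.iter (b - a) f x)).
  - apply (inv_pair_iter f fi a Hp).
  - rewrite <- Nat.iter_add. f_equal; lia.
Qed.

Lemma iter_f_fi k x : Nat.iter k f (Nat.iter k fi x) = x.
Proof. apply (inv_pair_iter f fi); exact Hp. Qed.

Lemma iter_inj k x y : Nat.iter k f x = Nat.iter k f y -> x = y.
Proof. apply (inv_pair_inj _ (Nat.iter k fi)), inv_pair_iter; exact Hp. Qed.

Lemma nonperiodic_inj x : ~ periodic x -> forall i j, Nat.iter i f x = Nat.iter j f x -> i = j.
Proof.
  intros Hx. assert (A : forall i k, Nat.iter i f x = Nat.iter (i + S k) f x -> False).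
  { intros i k H. apply Hx. exists (S k); split; [lia|]. rewrite Nat.iter_add in H. apply iter_inj in H; auto. }
  intros i j H. destruct (lt_eq_lt_dec i j) as [[L|L]|L]; [exfalso|exact L|exfalso].
  - apply (A i (j - i - 1)%nat). replace (i + S (j - i - 1))%nat with j by lia; exact H.
  - apply (A j (i - j - 1)%nat). replace (j + S (i - j - 1))%nat with i by lia; auto.
Qed.

Lemma nonperiodic_inj_back x : ~ periodic x -> forall i j, Nat.iter i fi x = Nat.iter j fi x -> i = j.
Proof.
  intros Hx i j H. apply (f_equal (Nat.iter (i + j) f)) in H.
  assert (L : forall a b, Nat.iter (a + b) f (Nat.iter b fi x) = Nat.iter a f x).
  { intros; rewrite Nat.iter_add, iter_f_fi; reflexivity. }
  rewrite L in H. replace (i + j)%nat with (j + i)%nat in H by lia. rewrite L in H.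
  symmetry; exact (nonperiodic_inj x Hx _ _ H).
Qed.

Lemma iter_comm i j x : Nat.iter i f (Nat.iter j f x) = Nat.iter j f (Nat.iter i f x).
Proof. rewrite <- !Nat.iter_add, Nat.add_comm; reflexivity. Qed.

Lemma periodic_iter k x : periodic (Nat.iter k fi x) -> periodic x.
Proof.
  intros (r & Hr & H). exists r; split; [exact Hr|]. rewrite <- (iter_f_fi k x).
  rewrite iter_comm, H; reflexivity.
Qed.

(** The backward orbit is infinite and eventually leaves the finite list; its last visit there is
    the source. *)
Lemma source_exists e : In e E -> ~ periodic e -> exists a p, source p /\ e = Nat.iter a f p.
Proof.
  intros He Hne. destruct (eventually_avoids (fun n => Nat.iter n fi e) E) as [n0 Hn0].
  { apply nonperiodic_inj_back; exact Hne. }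
  assert (Hlast : exists a, In (Nat.iter a fi e) E /\ forall j, (a < j)%nat -> ~ In (Nat.iter j fi e) E).
  { induction n0 as [|n0 IH]; [exfalso; apply (Hn0 O); [lia|exact He]|].
    destruct (classic (In (Nat.iter n0 fi e) E)) as [Hin|Hin].
    - exists n0; split; [exact Hin|]. intros j Hj; apply Hn0; lia.
    - apply IH. intros n Hn. destruct (Nat.eq_dec n n0) as [->|]; [exact Hin|apply Hn0; lia]. }
  destruct Hlast as (a & Ha & Hj). exists a, (Nat.iter a fi e). split; [|symmetry; apply iter_f_fi].
  split; [exact Ha|]. split.
  - intro H; apply Hne; eapply periodic_iter; exact H.
  - intros j Hj1. rewrite <- Nat.iter_add. apply Hj; lia.
Qed.

(* Otherwise [f^n] is singular at the points [fi^j p] for all [j <= n - m]. *)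
Lemma source_germ p m : source p -> (forall n, (m <= n)%nat -> ~ In (Nat.iter n f p) E) -> locally_linear (Nat.iter m f) p.
Proof.
  intros (Hin & Hnp & Hback) Hfwd. apply NNPP; intro HnLL. apply HnLG.
  (* The [n - m + 1] distinct points found below give [n <= A + m]; for [n < m] the additive
     constant is enough. *)
  exists (m + 1)%nat. intros n A L (E' & HA & HB).
  destruct (le_lt_dec m n) as [Hmn|]; [|nia].
  assert (Lj : forall j, locally_linear (Nat.iter j f) (Nat.iter j fi p)).
  { induction j as [|j IH]; [apply locally_linear_id|].
    assert (Es : f (Nat.iter (S j) fi p) = Nat.iter j fi p) by (apply Hp).
    replace (Nat.iter (S j) f) with (fun y => Nat.iter j f (f y))
      by (apply functional_extensionality; intro; symmetry; apply Nat.iter_succ_r).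
    apply locally_linear_comp; [apply HE, Hback; lia|]. rewrite Es; exact IH. }
  assert (Lk : forall k, locally_linear (Nat.iter k f) (Nat.iter m f p)).
  { induction k as [|k IH]; [apply locally_linear_id|]. apply (locally_linear_comp (Nat.iter k f) f); [exact IH|].
    rewrite <- Nat.iter_add. apply HE, Hfwd; lia. }
  assert (Hall : forall j, (j <= n - m)%nat -> In (Nat.iter j fi p) E').
  { intros j Hj. apply NNPP; intro Hn. destruct (HB _ Hn) as (d & Hd & _).
    apply HnLL. set (k := (n - m - j)%nat).
    assert (En : forall y, Nat.iter n f y = Nat.iter k f (Nat.iter m f (Nat.iter j f y))).
    { intro y. rewrite <- !Nat.iter_add. f_equal. unfold k; lia. }
    (* If [f^n] were linear at [fi^j p], stripping the linear germs of the first [j] and the last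
       [k] steps would make [f^m] linear at [p]. *)
    replace (Nat.iter m f) with (fun y => Nat.iter k fi (Nat.iter n f (Nat.iter j fi y))).
    - apply (locally_linear_comp (fun y => Nat.iter n f (Nat.iter j fi y)) (Nat.iter k fi)).
      + apply (locally_linear_comp (Nat.iter j fi) (Nat.iter n f)); [|exists d; exact Hd].
        rewrite <- (iter_f_fi j p) at 1. apply (locally_linear_inv (Nat.iter j f)); [apply inv_pair_iter; exact Hp|apply Lj].
      + rewrite En, iter_f_fi. apply (locally_linear_inv (Nat.iter k f)); [apply inv_pair_iter; exact Hp|apply Lk].
    - apply functional_extensionality; intro y. rewrite En, iter_f_fi.
      apply (inv_pair_iter f fi k Hp). }
  assert (Hnd : NoDup (map (fun j => Nat.iter j fi p) (seq 0 (S (n - m))))).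
  { apply NoDup_map_NoDup_ForallPairs; [|apply seq_NoDup].
    intros i j _ _. apply nonperiodic_inj_back; exact Hnp. }
  pose proof (NoDup_incl_length Hnd (l' := E')) as Hl. rewrite length_map, length_seq in Hl.
  assert (Hincl : incl (map (fun j => Nat.iter j fi p) (seq 0 (S (n - m)))) E').
  { intros v Hv. apply in_map_iff in Hv. destruct Hv as (j & <- & Hj). apply in_seq in Hj. apply Hall; lia. }
  specialize (Hl Hincl). nia.
Qed.

(** Both properties survive passing to a multiple of the time, so the times for the individual
    points are multiplied. For a periodic point, [fixed_point_dichotomy] leaves only the case that a
    power is the identity nearby. *)
Lemma uniform_time : exists m, (2 <= m)%nat /\ forall e, In e E ->
  (periodic e -> exists N, forall y, agree N e y -> Nat.iter m f y = y) /\
  (~ periodic e -> forall n, (m <= n)%nat -> ~ In (Nat.iter n f e) E).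
Proof.
  assert (H : forall l, incl l E -> exists m, (2 <= m)%nat /\ forall e, In e l ->
    (periodic e -> exists N, forall y, agree N e y -> Nat.iter m f y = y) /\
    (~ periodic e -> forall n, (m <= n)%nat -> ~ In (Nat.iter n f e) E)); [|apply H, incl_refl].
  induction l as [|e l IH]; intro Hl.
  - exists 2%nat; split; [lia|]. intros e [].
  - destruct IH as (m & Hm & IH); [intros x Hx; apply Hl; right; exact Hx|].
    assert (Hnew : exists k, (1 <= k)%nat /\
      (periodic e -> exists N, forall y, agree N e y -> Nat.iter k f y = y) /\
      (~ periodic e -> forall n, (k <= n)%nat -> ~ In (Nat.iter n f e) E)).
    { destruct (classic (periodic e)) as [Hper|Hper].
      - pose proof Hper as (k & Hk & Hke). exists k; split; [exact Hk|]. split; [intros _|tauto].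
        destruct (fixed_point_dichotomy (Nat.iter k f) (Nat.iter k fi) e) as [HL|HN]; auto.
        + apply inv_pair_iter; exact Hp.
        + apply tame_iter; exact HG.
        + exfalso; apply HnLG. destruct (tame_bounded_by f HG) as (A0 & L0 & HB).
          apply (linear_growth_iter f fi A0 L0 k); assumption.
      - destruct (eventually_avoids (fun n => Nat.iter n f e) E) as [n0 Hn0].
        { apply nonperiodic_inj; exact Hper. }
        exists (S n0); split; [lia|]. split; [tauto|]. intros _ n Hn; apply Hn0; lia. }
    destruct Hnew as (k & Hk & K1 & K2).
    exists (m * k)%nat. split; [nia|]. intros x [<-|Hx].
    + split; [|intros Hne n Hn; apply K2; [exact Hne|nia]].
      intro Hper. destruct (K1 Hper) as [N HN]. exists N; intros y Hy. apply iter_periodic; auto.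
    + destruct (IH x Hx) as [I1 I2]. split; [|intros Hne n Hn; apply I2; [exact Hne|nia]].
      intro Hper. destruct (I1 Hper) as [N HN]. exists N; intros y Hy.
      rewrite Nat.mul_comm. apply iter_periodic; auto.
Qed.

(** For the last clause, [f^i p] is never a source, since [p] lies in [E] on its backward orbit;
    continuity then separates small cones. *)
Lemma uniform_depth m : (2 <= m)%nat ->
  (forall e, In e E ->
    (periodic e -> exists N, forall y, agree N e y -> Nat.iter m f y = y) /\
    (~ periodic e -> forall n, (m <= n)%nat -> ~ In (Nat.iter n f e) E)) ->
  exists N,
    (forall p, source p -> exists M, prefix_map (Nat.iter m f) p N M) /\
    (forall e y, In e E -> periodic e -> agree N e y -> Nat.iter m f y = y) /\
    (forall p p' i x, source p -> source p' -> (1 <= i < m)%nat ->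
       agree N p x -> ~ agree N p' (Nat.iter i f x)).
Proof.
  intros Hm Hu.
  destruct (uniform_over_list (fun p N => source p -> exists M, prefix_map (Nat.iter m f) p N M) E) as [N1 H1].
  { intros p Hin. destruct (classic (source p)) as [Hs|]; [|exists O; tauto].
    destruct (source_germ p m Hs) as [d (N & M & HP & _)].
    { apply Hu; [exact Hin|apply Hs]. }
    exists N; intros N' HN _. exists (M + (N' - N))%nat.
    replace N' with (N + (N' - N))%nat at 1 by lia. apply prefix_map_raise; exact HP. }
  destruct (uniform_over_list (fun e N => periodic e -> forall y, agree N e y -> Nat.iter m f y = y) E) as [N2 H2].
  { intros e Hin. destruct (classic (periodic e)) as [Hs|]; [|exists O; tauto].
    destruct (proj1 (Hu e Hin) Hs) as [N HN].
    exists N; intros N' HN' _ y Hy. apply HN. eapply agree_le; eauto. }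
  destruct (uniform_over_list (fun q N => source (fst (fst q)) -> source (snd (fst q)) -> (1 <= snd q)%nat ->
     forall x, agree N (fst (fst q)) x -> ~ agree N (snd (fst q)) (Nat.iter (snd q) f x))
     (list_prod (list_prod E E) (seq 0 m))) as [N3 H3].
  { intros [[p p'] i] _; simpl. destruct (classic (source p /\ source p' /\ (1 <= i)%nat)) as [(S1 & S2 & Hi)|];
      [|exists O; tauto].
    assert (Hne : p' <> Nat.iter i f p).
    { intros ->. destruct S2 as (_ & _ & S2). apply (S2 i Hi).
      rewrite (proj1 (inv_pair_iter f fi i Hp)). apply S1. }
    destruct (neq_not_agree _ _ Hne) as [k Hk].
    destruct (cantor_continuous_iter f i (tame_cantor_continuous f HG) p k) as [N HN].
    exists (N + k)%nat. intros N' HN' _ _ _ x Hx Hx'. apply Hk.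
    apply agree_trans with (Nat.iter i f x).
    - eapply agree_le; [|exact Hx']; lia.
    - apply agree_sym, HN. eapply agree_le; [|exact Hx]; lia. }
  exists (N1 + N2 + N3)%nat. split; [|split].
  - intros p Hs. apply H1; [lia|apply Hs|exact Hs].
  - intros e y Hin Hper Hy. apply (H2 (N1 + N2 + N3)%nat ltac:(lia) e Hin Hper); exact Hy.
  - intros p p' i x S1 S2 Hi Hx. apply (H3 (N1 + N2 + N3)%nat ltac:(lia) (p, p', i)); simpl; try assumption; [|lia].
    apply in_prod; [apply in_prod; [apply S1|apply S2]|apply in_seq; lia].
Qed.

(** * The first return map to the base *)

Section Induced.

Variables (m N : nat).
Hypothesis Hm : (2 <= m)%nat.
Hypothesis Hexit : forall p, source p -> forall n, (m <= n)%nat -> ~ In (Nat.iter n f p) E.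
Hypothesis HPR : forall p, source p -> exists M, prefix_map (Nat.iter m f) p N M.
Hypothesis Hper : forall e y, In e E -> periodic e -> agree N e y -> Nat.iter m f y = y.
Hypothesis Hdisj : forall p p' i x, source p -> source p' -> (1 <= i < m)%nat ->
  agree N p x -> ~ agree N p' (Nat.iter i f x).

(** Closing up under preimages makes the set invariant: forward images are preimages too, because
    [f^m] is the identity on it. *)
Definition near_periodic x := exists q i, In q E /\ periodic q /\ agree N q (Nat.iter i f x).
Definition near_source x := exists p, source p /\ agree N p x.
Definition in_tower x := exists i, (1 <= i < m)%nat /\ near_source (Nat.iter i fi x).

(* Off the towers over the sources and the periodic singularities, the map [f^tau] has no singularities. *)
Definition base x := ~ near_periodic x /\ ~ in_tower x.
Definition tau x : nat := if excluded_middle_informative (near_source x) then m else 1%nat.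

Lemma near_periodic_fixed x : near_periodic x -> Nat.iter m f x = x.
Proof.
  intros (q & i & Hq & Hqp & Ha). apply (iter_inj i).
  rewrite iter_comm. eapply Hper; eauto.
Qed.

Lemma near_periodic_back n x : near_periodic (Nat.iter n f x) -> near_periodic x.
Proof.
  intros (q & i & Hq & Hqp & Ha). exists q, (i + n)%nat. rewrite Nat.iter_add; auto.
Qed.

(** By periodicity, [n * m - n] further steps lead from [f^n x] back to [x]. *)
Lemma near_periodic_fwd n x : near_periodic x -> near_periodic (Nat.iter n f x).
Proof.
  intros H. apply (near_periodic_back (n * m - n)%nat). rewrite <- Nat.iter_add.
  replace (n * m - n + n)%nat with (n * m)%nat by nia.
  rewrite iter_periodic; [exact H|apply near_periodic_fixed; exact H].
Qed.

Lemma near_periodic_fi n x : near_periodic (Nat.iter n fi x) -> near_periodic x.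
Proof. intros H. rewrite <- (iter_f_fi n x). apply near_periodic_fwd; exact H. Qed.

Lemma tower_disjoint i x : (1 <= i < m)%nat -> near_source x -> ~ near_source (Nat.iter i f x).
Proof. intros Hi (p & Sp & Hx) (p' & Sp' & Hx'). exact (Hdisj p p' i x Sp Sp' Hi Hx Hx'). Qed.

(** A jump of [m] steps from a source cone cannot land in a tower, since an earlier point of the
    passage would lie in a source cone. A single step into level [i] of a tower would start in a
    source cone or on level [i - 1]. *)
Lemma base_invariant x : base x -> base (Nat.iter (tau x) f x).
Proof.
  intros [H1 H2]. unfold tau. destruct (excluded_middle_informative (near_source x)) as [Hs|Hs]; split.
  - intro K; apply H1; eapply near_periodic_back; exact K.
  - intros (i & Hi & K). rewrite iter_cancel in K by lia. apply (tower_disjoint (m - i) x); [lia| |]; assumption.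
  - intro K; apply H1. apply (near_periodic_back 1); exact K.
  - intros (i & Hi & K). destruct i as [|i]; [lia|].
    rewrite Nat.iter_succ_r in K. simpl (Nat.iter 1 f x) in K. rewrite (proj1 Hp) in K.
    destruct i as [|i]; [exact (Hs K)|]. apply H2. exists (S i); split; [lia|exact K].
Qed.

(** A nonperiodic singularity is reached from a source in [a] steps: [a = 0] puts it in a source
    cone, [1 <= a < m] in a tower, and [a >= m] is excluded by [Hexit]. *)
Lemma base_locally_linear x : base x -> locally_linear (Nat.iter (tau x) f) x.
Proof.
  intros [H1 H2]. unfold tau. destruct (excluded_middle_informative (near_source x)) as [Hs|Hs].
  - destruct Hs as (p & Sp & Hx). destruct (HPR p Sp) as [M HM].
    eexists. apply prefix_map_log_contraction. eapply prefix_map_near; eauto.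
  - apply HE; intro Hin. destruct (classic (periodic x)) as [Hx|Hx].
    + apply H1. exists x, O. split; [exact Hin|]. split; [exact Hx|]. apply agree_refl.
    + destruct (source_exists x Hin Hx) as (a & p & Sp & ->).
      destruct a as [|a]; [apply Hs; exists p; split; [exact Sp|apply agree_refl]|].
      destruct (le_lt_dec m (S a)) as [Hle|Hlt]; [exact (Hexit p Sp _ Hle Hin)|].
      apply H2. exists (S a); split; [lia|]. rewrite (proj1 (inv_pair_iter f fi (S a) Hp)).
      exists p; split; [exact Sp|apply agree_refl].
Qed.

Lemma near_source_agree x y : agree N x y -> near_source x -> near_source y.
Proof. intros H (p & Sp & Hx). exists p; split; [exact Sp|eapply agree_trans; eauto]. Qed.

Lemma tau_agree x y : agree N x y -> tau x = tau y.
Proof.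
  intros H. unfold tau.
  destruct (excluded_middle_informative (near_source x)) as [Hx|Hx],
    (excluded_middle_informative (near_source y)) as [Hy|Hy]; try reflexivity; exfalso.
  - apply Hy; eapply near_source_agree; eauto.
  - apply Hx; eapply near_source_agree; [apply agree_sym|]; eauto.
Qed.

Lemma base_closed x : ~ base x -> exists n, forall y, agree n x y -> ~ base y.
Proof.
  intros H. assert (Hcf : cantor_continuous f) by (apply tame_cantor_continuous; exact HG).
  assert (Hcfi : cantor_continuous fi) by (apply (cantor_continuous_inv f); assumption).
  destruct (classic (near_periodic x)) as [(q & i & Hq & Hqp & Ha)|Hz].
  - destruct (cantor_continuous_iter f i Hcf x N) as [n Hn]. exists n; intros y Hy [K _]. apply K.
    exists q, i. split; [exact Hq|]. split; [exact Hqp|]. eapply agree_trans; eauto.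
  - destruct (classic (in_tower x)) as [(i & Hi & Hs)|Ht]; [|exfalso; apply H; split; assumption].
    destruct (cantor_continuous_iter fi i Hcfi x N) as [n Hn]. exists n; intros y Hy [_ K]. apply K.
    exists i; split; [exact Hi|]. eapply near_source_agree; eauto.
Qed.

(** The base is closed and [tau] is locally constant, so compactness turns the local prefix
    replacements into ones of a common depth. *)
Lemma induced_uniform : exists D B, forall x, base x ->
  exists M, (M <= D + B)%nat /\ prefix_map (Nat.iter (tau x) f) x D M.
Proof.
  destruct (cantor_compact (fun n y => base y -> exists k M, (k <= n)%nat /\ (M <= n)%nat /\
     prefix_map (Nat.iter (tau y) f) y k M)) as [n Hn].
  - intros n n' x Hnn H Hx. destruct (H Hx) as (k & M & H1 & H2 & H3).
    exists k, M; repeat split; [lia|lia|exact H3].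
  - intro x. destruct (classic (base x)) as [Hx|Hx].
    + destruct (base_locally_linear x Hx) as [d (k & M & HP & _)]. exists (N + k + M)%nat. intros y Hy _.
      exists k, M. split; [lia|]. split; [lia|].
      rewrite <- (tau_agree x y) by (eapply agree_le; [|exact Hy]; lia).
      eapply prefix_map_near; [exact HP|]. eapply agree_le; [|exact Hy]; lia.
    + destruct (base_closed x Hx) as [n Hn]. exists n; intros y Hy Hb. exfalso; exact (Hn y Hy Hb).
  - exists n, n. intros x Hx. destruct (Hn x Hx) as (k & M & H1 & H2 & H3).
    exists (M + (n - k))%nat. split; [lia|].
    replace n with (k + (n - k))%nat at 1 by lia. apply prefix_map_raise; exact H3.
Qed.

(** Tower points are images of base points under powers of [f], and near-periodic points have period
    [m], so [P * m] works everywhere. *)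
Lemma induced_finite_order : exists P, (1 <= P)%nat /\ forall x, Nat.iter P f x = x.
Proof.
  destruct induced_uniform as (D & B & HDB).
  destruct (uniform_period f fi base tau m D B) as (P & HP & Hfix); auto.
  - intro x; unfold tau. destruct (excluded_middle_informative _); lia.
  - exact base_invariant.
  - assert (Hz : forall x, near_periodic x -> Nat.iter (P * m) f x = x).
    { intros x Hx. apply iter_periodic, near_periodic_fixed; exact Hx. }
    assert (Hb : forall x, base x -> Nat.iter (P * m) f x = x).
    { intros x Hx. rewrite Nat.mul_comm. apply iter_periodic, Hfix; exact Hx. }
    exists (P * m)%nat. split; [nia|]. intro x.
    destruct (classic (near_periodic x)) as [Hx|Hx]; [auto|].
    destruct (classic (in_tower x)) as [(i & Hi & Hs)|Ht]; [|apply Hb; split; assumption].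
    set (y := Nat.iter i fi x) in *. assert (Ey : x = Nat.iter i f y) by (symmetry; apply iter_f_fi).
    assert (Hy : base y).
    { split; [intro K; apply Hx; eapply near_periodic_fi; exact K|].
      intros (j & Hj & K). apply (tower_disjoint j _ Hj K). rewrite iter_f_fi; exact Hs. }
    rewrite Ey, iter_comm, Hb by exact Hy. reflexivity.
Qed.

End Induced.

Lemma finite_order : exists P, (1 <= P)%nat /\ forall x, Nat.iter P f x = x.
Proof.
  destruct uniform_time as (m & Hm & Hu). destruct (uniform_depth m Hm Hu) as (N & H1 & H2 & H3).
  apply (induced_finite_order m N); auto.
  intros p Sp. apply Hu; apply Sp.
Qed.

End Singularities.

Lemma infinite_order_linear_growth f : tame f -> infinite_order f -> linear_growth f.
Proof.
  intros HG Hinf. apply NNPP; intro HnLG. pose proof HG as ([fi Hp] & [E HE] & _).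
  destruct (finite_order f fi E Hp HG HE HnLG) as (P & HP & H). exact (Hinf P HP H).
Qed.

Theorem mainTheorem1 (S : list (Cantor -> Cantor)) (f : Cantor -> Cantor) :
  genSetVA S -> inVA f -> infinite_order f ->
  exists C : R, 0 < C /\
    forall (k : Z) (g : Cantor -> Cantor) (w : list (bool * (Cantor -> Cantor))),
      zpow f k g -> wordOver S w -> represents w g ->
      IZR (Z.abs k) <= C * INR (length w) + C.
Proof.
  intros [HS _] Hf Hinf. apply inVA_tame in Hf.
  destruct (infinite_order_linear_growth f Hf Hinf) as [C HC].
  assert (HK : exists K, forall s, In s S -> tame s /\ bounded_by s K K).
  { destruct (uniform_over_list (fun s K => tame s /\ bounded_by s K K) S) as [K HK].
    - intros s Hs. pose proof (inVA_tame s (HS s Hs)) as HG. destruct (tame_bounded_by s HG) as (A & L & HB).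
      exists (A + L)%nat; intros K HK; split; [exact HG|]. apply (bounded_by_mono _ A L); [lia|lia|exact HB].
    - exists K; apply HK; lia. }
  destruct HK as [K HK].
  (* A word of length [l] gives both bounds [K * l], so their sum is [2 * K * l]; the final 1 makes
     the constant positive. *)
  exists (INR (2 * C * K + C + 1)). split; [apply lt_0_INR; lia|].
  intros k g w Hz Hw Hr. apply represents_eq in Hr.
  pose proof (evalw_bounded_by K S w g HK Hw Hr) as HB.
  (* For negative exponents the bounds are transferred from the inverse, so only nonnegative powers
     of [f] have to be estimated. *)
  assert (HBf : bounded_by (Nat.iter (Z.to_nat (Z.abs k)) f) (K * length w) (K * length w)).
  { destruct Hz as [[Hk Hg]|[Hk (fi & F1 & F2 & Hg)]].
    - replace (Z.abs k) with k by lia.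
      replace (Nat.iter (Z.to_nat k) f) with g; [exact HB|apply functional_extensionality; exact Hg].
    - replace (Z.abs k) with (- k)%Z by lia.
      apply (bounded_by_inv (Nat.iter (Z.to_nat (- k)) fi)).
      + apply inv_pair_iter; split; assumption.
      + replace (Nat.iter (Z.to_nat (- k)) fi) with g; [exact HB|apply functional_extensionality; exact Hg]. }
  apply HC in HBf. rewrite <- (Z2Nat.id (Z.abs k)) by lia. rewrite <- INR_IZR_INZ, <- mult_INR, <- plus_INR.
  apply le_INR. nia.
Qed.
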